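(* Let $g>0$ and $k_0>0$, and let $\{(v(s),M(s)):s\in(-\varepsilon,\varepsilon)\}\subset\mathcal{U}\times\mathbb{R}$ be the local bifurcation branch of even, mean-zero, $\tfrac{2\pi}{k_0}$-periodic solutions of $F(v,M)=0$ bifurcating from $(0,M^*(k_0))$, where $M^*(k_0)=4g+4k_0^2$. Then there exists $s_0>0$ such that for every $|s|<s_0$ the function $h(s)=1+v(s)$ is an $L^2$-spectrally unstable stationary solution of $$\partial_t h+\partial_x\Bigl(h^3(\partial_x^3h-g\,\partial_xh)+M\frac{h^2}{(1+h)^2}\partial_xh\Bigr)=0,\qquad M=M(s).$$
   Context: Let $H^2_{\mathrm{per}}$, $L^2_{\mathrm{per}}$ be the spaces of $\tfrac{2\pi}{k_0}$-periodic functions in $H^2_{\mathrm{loc}}(\mathbb R)$, $L^2_{\mathrm{loc}}(\mathbb R)$, with norms on $(-\tfrac{\pi}{k_0},\tfrac{\pi}{k_0})$. Let $\mathcal{X}=\{v\in H^2_{\mathrm{per}}: v\text{ even},\ \int_{-\pi/k_0}^{\pi/k_0}v\,\mathrm{d}x=0\}$, $\mathcal{U}=\{v\in\mathcal{X}:v>-1\}$ and $$F(v,M)=\partial_x^2v-gv+M\Bigl(\frac{1}{2+v}+\log\frac{1+v}{2+v}\Bigr)-MK(v),\quad K(v)=\frac{k_0}{2\pi}\int_{-\pi/k_0}^{\pi/k_0}\Bigl(\frac{1}{2+v}+\log\frac{1+v}{2+v}\Bigr)\mathrm{d}x .$$ If $v\in\mathcal U$ and $F(v,M)=0$, then $h=1+v$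 is a positive stationary solution of the thin-film equation. The local bifurcation branch is the curve of solutions of $F(v,M)=0$ in $\mathcal U\times\mathbb R$ given by the Crandall–Rabinowitz theorem at $(0,M^*(k_0))$; it satisfies $v(s)=s\cos(k_0x)+\tau(s)$ with $\tau(s)=O(s^2)$ in $\mathcal X$ and $M(s)=M^*(k_0)+O(s^2)$. The linearisation of the thin-film equation about a stationary solution $h$ (with parameter $M$) is the operator on $L^2(\mathbb{R})$ with domain $H^4(\mathbb{R})$ $$\mathcal{L}u=-\partial_x\Bigl(h^3(\partial_x^3u-g\partial_xu)+3h^2(\partial_x^3h-g\partial_xh)u+M\frac{h^2}{(1+h)^2}\partial_xu+M\frac{2h\,\partial_xh}{(1+h)^3}u\Bigr).$$ The solution $h$ is $L^2$-spectrally stable if the $L^2(\mathbb{R})$-spectrum of $\mathcal{L}$ is contained in $\{\lambda\in\mathbb{C}:\operatorname{Re}\lambda\le0\}$; otherwise it is $L^2$-spectrally unstable. *)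

(* Defs.v *)
From HB Require Import structures.
From mathcomp Require Import all_boot all_order all_algebra.
From mathcomp Require Import all_classical all_reals all_analysis.
From mathcomp Require Import complex.

Set Implicit Arguments.
Unset Strict Implicit.
Unset Printing Implicit Defensive.
Import Order.TTheory GRing.Theory Num.Theory.
Import numFieldNormedType.Exports.

Local Open Scope ring_scope.
Local Open Scope complex_scope.
Local Open Scope classical_set_scope.

Local Notation leb := (@lebesgue_measure _).

(* Elements of L^2 and H^n are represented by functions, so equalities between
   them are almost-everywhere equalities. *)
Definition L2 (R : realType) (D : set R) (f : R -> R) : Prop :=
  measurable_fun D f /\ (\int[leb]_(x in D) ((f x) ^+ 2)%:E < +oo)%E.

Definition L2loc (R : realType) (f : R -> R) : Prop :=
  forall a b : R, L2 `[a, b] f.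

(* Test functions are C^1 with compact support; by mollification this class
   defines the same weak derivatives as the smooth compactly supported one. *)
Definition test_function (R : realType) (phi : R -> R) : Prop :=
  [/\ forall x, derivable phi x 1,
      continuous phi^`()%classic &
      exists r : R, forall x, r < `|x| -> phi x = 0].

Definition weak_derivative (R : realType) (f f' : R -> R) : Prop :=
  forall phi : R -> R, test_function phi ->
    \int[leb]_x (f x * phi^`()%classic x) = - \int[leb]_x (f' x * phi x).

Definition weakly_derivable (R : realType) (f : R -> R) : Prop :=
  exists f', L2loc f' /\ weak_derivative f f'.

(* The weak derivative is determined up to a null set; [wderiv f] is some
   representative, and 0 if f has no weak derivative in L^2_loc. *)
Definition wderiv (R : realType) (f : R -> R) : R -> R :=
  xget (fun=> 0) [set f' | L2loc f' /\ weak_derivative f f'].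

Fixpoint sobolev (R : realType) (P : (R -> R) -> Prop) (n : nat) (f : R -> R)
    : Prop :=
  P f /\
  if n is m.+1 then weakly_derivable f /\ sobolev P m (wderiv f) else True.

Section periodic.
Variables (R : realType) (k0 : R).

Definition cell : set R := `](- (pi / k0)), (pi / k0)[.

(* Continuity selects the continuous representative of the H^2_loc class, which
   gives a meaning to pointwise conditions such as v > -1. *)
Definition H2per (v : R -> R) : Prop :=
  [/\ forall x, v (x + 2 * pi / k0) = v x,
      continuous v &
      sobolev (@L2loc R) 2 v].

Definition H2per_norm (v : R -> R) : R :=
  Num.sqrt (\sum_(i < 3) \int[leb]_(x in cell) (iter i (@wderiv R) v x) ^+ 2).

Definition spaceX (v : R -> R) : Prop :=
  [/\ H2per v, forall x, v (- x) = v x & \int[leb]_(x in cell) v x = 0].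

Definition spaceU (v : R -> R) : Prop := spaceX v /\ forall x, -1 < v x.

Definition potential (v : R -> R) (x : R) : R :=
  1 / (2 + v x) + ln ((1 + v x) / (2 + v x)).

Definition K (v : R -> R) : R :=
  k0 / (2 * pi) * \int[leb]_(x in cell) potential v x.

Definition F (g : R) (v : R -> R) (M : R) (x : R) : R :=
  wderiv (wderiv v) x - g * v x + M * potential v x - M * K v.

Definition Mstar (g : R) : R := 4 * g + 4 * k0 ^+ 2.

(* The curve s |-> (v s, M s) is only meaningful for |s| < eps. *)
Record local_bifurcation_branch (g eps : R) (v : R -> R -> R) (M : R -> R)
    : Prop := LocalBifurcationBranch {
  branch_inU : forall s, `|s| < eps -> spaceU (v s);
  branch_solution : forall s, `|s| < eps ->
    \forall x \ae leb, F g (v s) (M s) x = 0;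
  branch_continuous_v : forall s, `|s| < eps ->
    H2per_norm (v t \- v s) @[t --> s] --> (0 : R);
  branch_continuous_M : forall s, `|s| < eps -> M t @[t --> s] --> M s;
  branch_expansion_v : exists C : R, \forall s \near (0 : R),
    H2per_norm (fun x => v s x - s * cos (k0 * x)) <= C * s ^+ 2;
  branch_expansion_M : exists C : R, \forall s \near (0 : R),
    `|M s - Mstar g| <= C * s ^+ 2
}.

End periodic.

Section thin_film.
Variables (R : realType) (g M : R) (h : R -> R).

Definition flux (x : R) : R :=
  h x ^+ 3 * (h^`(3)%classic x - g * h^`()%classic x)
  + M * (h x ^+ 2 / (1 + h x) ^+ 2) * h^`()%classic x.

Definition stationary_solution : Prop :=
  [/\ forall x, 0 < h x,
      forall n, (n < 4)%N -> forall x, derivable h^`(n)%classic x 1,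
      continuous h^`(4)%classic &
      forall x, flux^`()%classic x = 0].

Definition cL2 (u : R -> R[i]) : Prop :=
  L2 setT (fun x => complex.Re (u x)) /\ L2 setT (fun x => complex.Im (u x)).

Definition cL2_norm (u : R -> R[i]) : \bar R :=
  ('N[leb]_2%:E[EFin \o (@ComplexField.Normc.normc R \o u)])%E.

Definition cH (n : nat) (u : R -> R[i]) : Prop :=
  sobolev (L2 setT) n (fun x => complex.Re (u x)) /\
  sobolev (L2 setT) n (fun x => complex.Im (u x)).

Definition cwderiv (u : R -> R[i]) (x : R) : R[i] :=
  wderiv (fun y => complex.Re (u y)) x +i* wderiv (fun y => complex.Im (u y)) x.

Definition linearised_flux (u : R -> R[i]) (x : R) : R[i] :=
  (h x ^+ 3)%:C * (iter 3 cwderiv u x - g%:C * cwderiv u x)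
  + (3 * h x ^+ 2 * (h^`(3)%classic x - g * h^`()%classic x))%:C * u x
  + (M * (h x ^+ 2 / (1 + h x) ^+ 2))%:C * cwderiv u x
  + (M * (2 * h x * h^`()%classic x / (1 + h x) ^+ 3))%:C * u x.

(* As an operator on L^2(R; C), its domain is [cH 4]. *)
Definition linearisation (u : R -> R[i]) (x : R) : R[i] :=
  - cwderiv (linearised_flux u) x.

(* T - l is a bijection from [dom] onto L^2(R; C) with bounded inverse. *)
Definition in_resolvent_set (dom : (R -> R[i]) -> Prop)
    (T : (R -> R[i]) -> R -> R[i]) (l : R[i]) : Prop :=
  (forall u, dom u ->
     (\forall x \ae leb, T u x - l * u x = 0) -> \forall x \ae leb, u x = 0) /\
  exists C : R, forall f, cL2 f ->
    exists u, [/\ dom u, \forall x \ae leb, T u x - l * u x = f x &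
                  (cL2_norm u <= C%:E * cL2_norm f)%E].

Definition spectrum dom T : set R[i] := ~` (in_resolvent_set dom T).

Definition spectrally_stable : Prop :=
  spectrum (cH 4) linearisation `<=` [set l | complex.Re l <= 0].

Definition spectrally_unstable : Prop := ~ spectrally_stable.

End thin_film.

(* Main.v *)
(** With [A u = u'' + V u], [V = M / (h (1 + h)^2) - g], the linearisation about a
    stationary [h] is [L = - d/dx (h^3 d/dx A)].  Writing [u = p'] turns it into
    [N p = - h^3 (p'''' + (V p')')], which is symmetric for the weight [h^-3],
    with quadratic form [E p = int (V p'^2 - p''^2)].  Near the bifurcation point [V]
    is close to [M^*/4 - g = k0^2], so [V >= k0^2 / 2] for small [s], and [E p > 0]
    for a slowly varying bump [p].  Hence [mu], the supremum of [E p / int h^-3 p^2],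
    is positive and finite, and it must lie in the spectrum of [L]: otherwise the
    resolvent, bounded for the norm of [p'], is bounded in [L^2(h^-3)] by symmetry,
    which contradicts Cauchy-Schwarz for the nonnegative form [mu - E] along a
    maximising sequence. *)

Require Import Defs.
From HB Require Import structures.
From mathcomp Require Import all_boot all_order all_algebra.
From mathcomp Require Import all_classical all_reals all_analysis.
From mathcomp Require Import measurable_realfun complex ring lra.
Import Order.TTheory GRing.Theory Num.Theory.
Import numFieldNormedType.Exports.
Local Open Scope ring_scope.
Local Open Scope classical_set_scope.
Set Implicit Arguments.
Unset Strict Implicit.
Unset Printing Implicit Defensive.

(** The factorisation of [L] rests on the identity [h^3 V' = 3 h^2 (h''' - g h') + 2 M h h' / (1 +
    h)^3], which follows from the stationary equation in the form
    [h''' = g h' - M h' / (h (1 + h)^2)]. At [h = 1] the factor [1 / (h (1 + h)^2)] equals 1/4,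
    whence the quotient [M^*/4]. That [u] has a primitive in L^2 comes from the equation itself: for
    [mu > 0], the resolvent equation [- flux' - mu u = q'] integrates to [p = - (flux + q) / mu],
    and both the flux and [q] are in L^2. The supremum need not be attained on the line, so the
    argument works with near-maximisers and never with an eigenfunction; periodicity of [h] enters
    it through uniform bounds on the coefficients. Weak derivatives are arbitrary representatives of
    their classes. Every equation is therefore transferred first to continuous representatives, by
    means of Lebesgue points, and all integrations by parts are done on C^1 functions. *)

Local Notation leb := (@lebesgue_measure _).
Local Notation "''intg' f" := (leb.-integrable setT (EFin \o f))
  (at level 10, f at level 8).


(** * Square-integrable functions and integration by parts on the line *)

Section integrals.
Context {R : realType}.
Implicit Types f g : R -> R.

Lemma intgD f g : 'intg f -> 'intg g -> 'intg (fun x => f x + g x).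
Proof. by move=> intf intg; exact: (integrableD measurableT intf intg). Qed.

Lemma intgB f g : 'intg f -> 'intg g -> 'intg (fun x => f x - g x).
Proof. by move=> intf intg; exact: (integrableB measurableT intf intg). Qed.

Lemma intgZ (c : R) f : 'intg f -> 'intg (fun x => c * f x).
Proof. by move=> intf; exact: (integrableZl measurableT c intf). Qed.

Lemma intg_meas f : 'intg f -> measurable_fun setT f.
Proof. by move/integrableP => [+ _]; move/measurable_EFinP. Qed.

Lemma intg_le f g : measurable_fun setT f -> (forall x, `|f x| <= g x) ->
  'intg g -> 'intg f.
Proof.
move=> mf fg; apply: le_integrable => //; first exact/measurable_EFinP.
by move=> x _; rewrite !abse_EFin lee_fin (le_trans (fg x))// ler_norm.
Qed.

Lemma cont_meas f : continuous f -> measurable_fun setT f.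
Proof. exact: continuous_measurable_fun. Qed.

Lemma L2P f : L2 setT f <-> measurable_fun setT f /\ 'intg (fun x => f x ^+ 2).
Proof.
split=> -[mf sqf]; split => //.
  apply/integrableP; split.
    by apply/measurable_EFinP; exact: measurable_funX.
  by under eq_integral do rewrite /= ger0_norm ?sqr_ge0//.
move/integrableP : sqf => [_].
by under eq_integral do rewrite /= ger0_norm ?sqr_ge0//.
Qed.

Lemma L2_meas f : L2 setT f -> measurable_fun setT f. Proof. by case. Qed.

Lemma L2_sq f : L2 setT f -> 'intg (fun x => f x ^+ 2).
Proof. by move/L2P => []. Qed.

Lemma L2_mul f g : L2 setT f -> L2 setT g -> 'intg (fun x => f x * g x).
Proof.
move=> /L2P[mf f2] /L2P[mg g2]; apply: intg_le (intgD f2 g2).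
  exact: measurable_funM.
move=> x; rewrite normrM -(real_normK (num_real (f x))).
rewrite -(real_normK (num_real (g x))).
set a := `|f x|; set b := `|g x|.
have a0 : 0 <= a := normr_ge0 _. have b0 : 0 <= b := normr_ge0 _.
nra.
Qed.

Lemma L2D f g : L2 setT f -> L2 setT g -> L2 setT (fun x => f x + g x).
Proof.
move=> /L2P[mf f2] /L2P[mg g2]; apply/L2P; split.
  exact: measurable_funD.
apply: intg_le (intgD (intgZ 2 f2) (intgZ 2 g2)).
  by apply: measurable_funX; exact: measurable_funD.
move=> x; rewrite ger0_norm ?sqr_ge0//; have := sqr_ge0 (f x - g x).
by rewrite sqrrB sqrrD; lra.
Qed.

Lemma L2_bdd (K : R) f g : measurable_fun setT f -> (forall x, `|f x| <= K) ->
  L2 setT g -> L2 setT (fun x => f x * g x).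
Proof.
move=> mf fK /L2P[mg g2]; apply/L2P; split; first exact: measurable_funM.
apply: intg_le (intgZ (K ^+ 2) g2).
  by apply: measurable_funX; exact: measurable_funM.
move=> x; rewrite ger0_norm ?sqr_ge0// exprMn ler_wpM2r ?sqr_ge0//.
by rewrite -(real_normK (num_real (f x))) lerXn2r// nnegrE// (le_trans _ (fK x)).
Qed.

Lemma L2Z (c : R) f : L2 setT f -> L2 setT (fun x => c * f x).
Proof. by apply: (@L2_bdd `|c|). Qed.

Lemma IntD f g : 'intg f -> 'intg g ->
  \int[leb]_x (f x + g x) = \int[leb]_x f x + \int[leb]_x g x.
Proof. by move=> *; rewrite RintegralD. Qed.

Lemma IntB f g : 'intg f -> 'intg g ->
  \int[leb]_x (f x - g x) = \int[leb]_x f x - \int[leb]_x g x.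
Proof. by move=> *; rewrite RintegralB. Qed.

Lemma IntZ (c : R) f : 'intg f -> \int[leb]_x (c * f x) = c * \int[leb]_x f x.
Proof. by move=> *; rewrite RintegralZl. Qed.

Lemma Int_le f g : 'intg f -> 'intg g -> (forall x, f x <= g x) ->
  \int[leb]_x f x <= \int[leb]_x g x.
Proof. by move=> intf intg fg; apply: le_Rintegral. Qed.

Lemma Int_ge0 f : (forall x, 0 <= f x) -> 0 <= \int[leb]_x f x.
Proof. by move=> f0; apply: Rintegral_ge0. Qed.

Lemma Int_dominated (f_ : nat -> R -> R) f g :
  (forall n, measurable_fun setT (f_ n)) ->
  (forall x, f_ n x @[n --> \oo] --> f x) ->
  'intg g -> (forall n x, `|f_ n x| <= g x) ->
  \int[leb]_x f_ n x @[n --> \oo] --> \int[leb]_x f x.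
Proof.
move=> mf_ f_f intg f_g.
have mf : measurable_fun setT f by apply: (measurable_fun_cvg mf_) => x _; exact: f_f.
have [|||||intf _ cvg] := @dominated_convergence _ _ R leb setT measurableT
    (fun n x => (f_ n x)%:E) (EFin \o f) (EFin \o g).
- by move=> n; apply/measurable_EFinP; exact: mf_.
- exact/measurable_EFinP.
- by apply: aeW => x _; apply: cvg_EFin; [exact: nearW | exact: f_f].
- by [].
- by apply: aeW => x n _; rewrite lee_fin.
- apply/fine_cvg; rewrite fineK//; exact: integrable_fin_num.
Qed.

End integrals.

Section derivatives.
Context {R : realType}.
Implicit Types (f g : R -> R) (x : R).

Lemma dvD f g x a b : is_derive x 1 f a -> is_derive x 1 g b ->
  is_derive x 1 (fun y => f y + g y) (a + b).
Proof. by move=> df dg; exact: is_deriveD. Qed.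

Lemma dvB f g x a b : is_derive x 1 f a -> is_derive x 1 g b ->
  is_derive x 1 (fun y => f y - g y) (a - b).
Proof. by move=> df dg; exact: is_deriveB. Qed.

Lemma dvM f g x a b : is_derive x 1 f a -> is_derive x 1 g b ->
  is_derive x 1 (fun y => f y * g y) (a * g x + f x * b).
Proof.
move=> df dg; have := @is_deriveM _ _ f g x 1 _ _ df dg.
by move/is_derive_eq; apply; rewrite /GRing.scale/= addrC (mulrC (g x)).
Qed.

Lemma dvZ (c : R) f x a : is_derive x 1 f a ->
  is_derive x 1 (fun y => c * f y) (c * a).
Proof. by move=> df; exact: (@is_deriveZ _ _ _ f c). Qed.

Lemma dv_comp f g x a b : is_derive x 1 g b -> is_derive (g x) 1 f a ->
  is_derive x 1 (fun y => f (g y)) (a * b).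
Proof. by move=> dg df; apply: is_derive_eq (@is_derive1_comp _ f g x _ _ df dg) _. Qed.

Lemma dv_cont f x a : is_derive x 1 f a -> {for x, continuous f}.
Proof.
by move=> [df _]; apply: differentiable_continuous; exact/derivable1_diffP.
Qed.

Lemma dv_affine (a b x : R) : is_derive x 1 (fun y => a * y + b) a.
Proof.
have := dvD (dvZ a (@is_derive_id _ _ x (1 : R))) (is_derive_cst b x 1).
by move/is_derive_eq; apply; rewrite mulr1 addr0.
Qed.

Lemma dvX f (n : nat) x a : is_derive x 1 f a ->
  is_derive x 1 (fun y => f y ^+ n) (n%:R * f x ^+ n.-1 * a).
Proof.
move=> df; elim: n => [|n IHn].
  by rewrite !mul0r; exact: (is_derive_cst (1 : R) x 1).
under eq_fun do rewrite exprS.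
apply: is_derive_eq (dvM df IHn) _; case: n {IHn} => [|n] /=.
  by rewrite !expr0; ring.
by rewrite -[n.+2]add1n natrD exprS; ring.
Qed.

Lemma dv_derive1 f x a : is_derive x 1 f a -> f^`()%classic x = a.
Proof. by move=> df; rewrite derive1E derive_val. Qed.

Lemma derive1_dv f x : derivable f x 1 -> is_derive x 1 f (f^`()%classic x).
Proof. by move=> df; rewrite derive1E; exact: derivableP. Qed.

End derivatives.

Definition C1 {R : realType} (f f' : R -> R) : Prop :=
  (forall x : R, is_derive x 1 f (f' x)) /\ continuous f'.

Section C1.
Context {R : realType}.
Implicit Types f g : R -> R.

Lemma C1_cont f f' : C1 f f' -> continuous f.
Proof. by move=> [df _] x; exact: dv_cont. Qed.

Lemma C1D f g f' g' : C1 f f' -> C1 g g' ->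
  C1 (fun x => f x + g x) (fun x => f' x + g' x).
Proof.
move=> [df cf] [dg cg]; split=> x; first exact: dvD.
by apply: (continuousD (cf x) (cg x)).
Qed.

Lemma C1M f g f' g' : C1 f f' -> C1 g g' ->
  C1 (fun x => f x * g x) (fun x => f' x * g x + f x * g' x).
Proof.
move=> f1 g1; have cf := C1_cont f1; have cg := C1_cont g1.
move: f1 g1 => [df cf'] [dg cg']; split=> x; first exact: dvM.
apply: (@continuousD _ _ _ (fun x => f' x * g x) (fun x => f x * g' x)).
  exact: (continuousM (cf' x) (cg x)).
exact: (continuousM (cf x) (cg' x)).
Qed.

Lemma C1Z (c : R) f f' : C1 f f' -> C1 (fun x => c * f x) (fun x => c * f' x).
Proof.
move=> [df cf]; split=> x; first exact: dvZ.
by apply: continuousM (cf x); exact: cst_continuous.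
Qed.

Lemma C1B f g f' g' : C1 f f' -> C1 g g' ->
  C1 (fun x => f x - g x) (fun x => f' x - g' x).
Proof.
move=> [df cf] [dg cg]; split=> x; first exact: dvB.
by apply: (continuousB (cf x) (cg x)).
Qed.

Lemma C1_affine_comp (a b : R) f f' : C1 f f' ->
  C1 (fun x => f (a * x + b)) (fun x => a * f' (a * x + b)).
Proof.
move=> [df cf]; split=> x.
  rewrite mulrC.
  exact: (dv_comp (dv_affine a b x) (df _)).
apply: continuousM; first exact: cst_continuous.
apply: continuous_comp (cf _).
by apply: (dv_cont (dv_affine a b x)).
Qed.

Lemma C1_FTC f f' (a b : R) : C1 f f' -> a < b ->
  \int[leb]_(x in `[a, b]) f' x = f b - f a.
Proof.
move=> f1 ab; have cf := C1_cont f1; move: f1 => [df cf'].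
rewrite /Rintegral (@continuous_FTC2 _ _ f)//.
- by apply: continuous_subspaceT.
- split.
  + by move=> x _; exact: (@ex_derive _ _ _ _ _ _ _ (df x)).
  + exact: cvg_at_right_filter (cf a).
  + exact: cvg_at_left_filter (cf b).
- by move=> x _; exact: dv_derive1.
Qed.

Lemma intg_cont_itv f (a b : R) : continuous f ->
  leb.-integrable `[a, b] (EFin \o f).
Proof.
move=> cf; apply: continuous_compact_integrable; first exact: segment_compact.
exact: continuous_subspaceT.
Qed.

Definition supported (r : R) f := forall x, r < `|x| -> f x = 0.

Lemma supported_patch r f : supported r f -> f = f \_ `[- r, r].
Proof.
move=> fr; apply/funext => x; rewrite patchE; case: ifPn => // /negP xr.
apply: fr; rewrite ltNge; apply/negP => xr'; apply: xr.
by rewrite inE/= in_itv/= -ler_norml.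
Qed.

Lemma Int_supported r f : supported r f ->
  \int[leb]_x f x = \int[leb]_(x in `[- r, r]) f x.
Proof.
move=> fr; rewrite [RHS]Rintegral_mkcond; apply: eq_Rintegral => x _.
by rewrite [in LHS](supported_patch fr).
Qed.

Lemma intg_supported r f : supported r f ->
  leb.-integrable `[- r, r] (EFin \o f) -> 'intg f.
Proof.
move=> fr /integrable_mkcond => /(_ (measurable_itv _)).
apply: eq_integrable => // x _.
by rewrite restrict_EFin/= [in RHS](supported_patch fr).
Qed.

Lemma intg_cont_supported r f : continuous f -> supported r f -> 'intg f.
Proof. by move=> cf fr; apply: (intg_supported fr); exact: intg_cont_itv. Qed.

Lemma supported_derive r f f' : C1 f f' -> supported r f -> supported r f'.
Proof.
move=> [df _] fr x rx.
have d0 : is_derive x 1 f 0.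
  apply: (near_eq_is_derive _ (is_derive_cst (0 : R) x 1)).
  near=> y; rewrite fr//; near: y.
  exact: (cvgr_gt _ (@norm_continuous R R x) _ rx).
by rewrite -(dv_derive1 (df x)) (dv_derive1 d0).
Unshelve. all: by end_near. Qed.

Lemma Int_derive_supported r f f' : C1 f f' -> supported r f ->
  \int[leb]_x f' x = 0.
Proof.
move=> f1 fr; have fr' := supported_derive f1 fr.
(* [supported r] says nothing at distance exactly [r], and [r] may be negative; enlarging to
   [|r| + 1] puts both end points where [f] vanishes. *)
have f'r1 : supported (`|r| + 1) f'.
  by move=> x rx; apply: fr'; rewrite (le_lt_trans (ler_norm _))// (lt_trans _ rx)// ltrDl.
have r0 : 0 <= `|r| := normr_ge0 r.
have r1 : r < `| `|r| + 1 | by rewrite ger0_norm; have := ler_norm r; lra.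
rewrite (Int_supported f'r1) (C1_FTC f1); last by lra.
by rewrite !fr ?subrr// normrN.
Qed.

End C1.

(** * Piecewise polynomial cutoffs *)

Section cutoff.
Context {R : realType}.
Implicit Types (t x : R).

Definition pos t := (t + `|t|) / 2.

Lemma pos_ge t : 0 <= t -> pos t = t.
Proof. by move=> t0; rewrite /pos ger0_norm//; lra. Qed.

Lemma pos_le t : t <= 0 -> pos t = 0.
Proof. by move=> t0; rewrite /pos ler0_norm//; lra. Qed.

Lemma pos_ge0 t : 0 <= pos t.
Proof. by have [t0|/ltW/pos_le ->//] := leP 0 t; rewrite pos_ge. Qed.

Lemma pos_cont : continuous pos.
Proof.
move=> t.
have nc : {for t, continuous (fun x : R => `|x|)} by exact: (@norm_continuous R R).
have ic : {for t, continuous (fun x : R => x)} by exact: cvg_id.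
exact: (continuousM (continuousD ic nc) (@cst_continuous _ _ _ _)).
Qed.

(** A quadratic remainder that is uniform across the kink at 0, so that [dv_quadratic] gives the
    derivative there as at any other point. *)
Lemma pos_sq_taylor t u : `|pos u ^+ 2 - pos t ^+ 2 - 2 * pos t * (u - t)| <= (u - t) ^+ 2.
Proof.
have t2 := sqr_ge0 t; have u2 := sqr_ge0 u; have ut2 := sqr_ge0 (u - t).
rewrite sqrrB in ut2 *.
have [t0|/ltW t0] := leP 0 t; have [u0|/ltW u0] := leP 0 u.
- by rewrite !pos_ge// ler_norml; apply/andP; split; lra.
- have tu : 0 <= t * - u by rewrite mulr_ge0// oppr_ge0.
  by rewrite (pos_ge t0) (pos_le u0) ler_norml; apply/andP; split; lra.
- have tu : 0 <= - t * u by rewrite mulr_ge0// oppr_ge0.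
  by rewrite (pos_ge u0) (pos_le t0) ler_norml; apply/andP; split; lra.
- have tu : 0 <= - t * - u by rewrite mulr_ge0// oppr_ge0.
  rewrite (pos_le u0) (pos_le t0) expr0n/= mulr0 mul0r !subr0 normr0.
  exact: ut2.
Qed.

Lemma dv_quadratic (f : R -> R) (x d K : R) :
  (forall y, `|f y - f x - d * (y - x)| <= K * (y - x) ^+ 2) ->
  is_derive x 1 f d.
Proof.
move=> fK.
have K0 : 0 <= K.
  by have := le_trans (normr_ge0 _) (fK (x + 1)); rewrite addrC addKr expr1n mulr1.
suff lim : h^-1 *: ((f \o shift x) (h *: (1 : R)) - f x) @[h --> 0^'] --> d.
  split; first by apply/cvg_ex; exists d.
  exact: cvg_lim lim.
apply/cvgrPdist_le => e e0; near=> h.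
have h0 : h != 0 by near: h; exact: nbhs_dnbhs_neq.
rewrite /= /GRing.scale/= mulr1.
have := fK (h + x); rewrite addrK => fh.
have -> : d - h^-1 * (f (h + x) - f x) = - (h^-1 * (f (h + x) - f x - d * h)).
  by field.
rewrite normrN normrM normfV ler_pdivrMl ?normr_gt0//.
rewrite (le_trans fh)// -(real_normK (num_real h)) expr2 mulrA mulrC.
rewrite ler_wpM2l//.
have he : `|h| <= e / (K + 1).
  by near: h; apply: dnbhs0_le; rewrite divr_gt0// ltr_wpDl.
rewrite (@le_trans _ _ ((K + 1) * `|h|))//.
  by rewrite ler_wpM2r// lerDl.
by rewrite mulrC -ler_pdivlMr// ltr_wpDl.
Unshelve. all: by end_near. Qed.

Lemma pos_sq_C1 : C1 (fun t => pos t ^+ 2) (fun t => 2 * pos t).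
Proof.
split=> t; last by apply: continuousM (@pos_cont t); exact: cst_continuous.
by apply: (@dv_quadratic _ _ _ 1) => u; rewrite mul1r; exact: pos_sq_taylor.
Qed.

Lemma pos_exp_C1 n : C1 (fun t => pos t ^+ n.+2) (fun t => n.+2%:R * pos t ^+ n.+1).
Proof.
elim: n => [|n IHn]; first by under [X in C1 _ X]eq_fun do rewrite expr1; exact: pos_sq_C1.
have idC1 : C1 (fun t : R => t) (fun _ => 1).
  by split => t; [exact: is_derive_id|exact: cst_continuous].
(* [pos] itself is not C^1, so the power is raised by multiplying with the smooth factor [t]. *)
have posM k t : pos t ^+ k.+1 * t = pos t ^+ k.+2.
  have [t0|t0] := leP 0 t; first by rewrite pos_ge// -exprSr.
  by rewrite pos_le ?(ltW t0)// !exprS !mul0r.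
have := C1M IHn idC1; congr C1; apply/funext => t; first exact: posM.
by rewrite mulr1 -(natr1 n.+2) -mulrA posM; ring.
Qed.

(** [hat] is the tent of height 1 on [0, 2], a second difference of [pos]; [step] is its primitive
    and climbs from 0 to 1 on that interval. *)
Definition step t := (pos t ^+ 2 - 2 * pos (t - 1) ^+ 2 + pos (t - 2) ^+ 2) / 2.
Definition hat t := pos t - 2 * pos (t - 1) + pos (t - 2).

Lemma step_C1 : C1 step hat.
Proof.
have sh (a : R) : C1 (fun t => pos (t - a) ^+ 2) (fun t => 2 * pos (t - a)).
  have := C1_affine_comp 1 (- a) pos_sq_C1.
  by congr C1; apply/funext => t; rewrite !mul1r.
have := C1Z (2^-1) (C1D (C1B pos_sq_C1 (C1Z 2 (sh 1))) (sh 2)).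
by congr C1; apply/funext => t; rewrite /step /hat; field.
Qed.

Lemma step_le0 t : t <= 0 -> step t = 0.
Proof. by move=> t0; rewrite /step !pos_le ?expr0n/=; lra. Qed.

Lemma step_ge2 t : 2 <= t -> step t = 1.
Proof.
by move=> t2; rewrite /step !pos_ge; lra.
Qed.

Lemma step_bound t : 0 <= step t <= 1.
Proof.
have [t0|t0] := leP t 0; first by rewrite step_le0// lexx ler01.
have [t1|t1] := leP t 1.
  by rewrite /step (pos_ge (ltW t0)) !pos_le; try lra; apply/andP; split; nra.
have [t2|t2] := leP t 2.
  rewrite /step (pos_ge (ltW t0)) (@pos_ge (t - 1)) ?(@pos_le (t - 2)); try lra.
  by apply/andP; split; nra.
by rewrite step_ge2 ?ler01 ?lexx//; exact: ltW.
Qed.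

Lemma hat_bound t : 0 <= hat t <= 1.
Proof.
rewrite /hat; have [t0|t0] := leP t 0; first by rewrite !pos_le; lra.
have [t1|t1] := leP t 1; first by rewrite (pos_ge (ltW t0)) !pos_le; lra.
have [t2|t2] := leP t 2.
  by rewrite (pos_ge (ltW t0)) (@pos_ge (t - 1)) ?(@pos_le (t - 2)); lra.
by rewrite !pos_ge; lra.
Qed.

Lemma hat_le0 t : t <= 0 -> hat t = 0.
Proof. by move=> t0; rewrite /hat !pos_le; lra. Qed.

Lemma hat_ge2 t : 2 <= t -> hat t = 0.
Proof. by move=> t2; rewrite /hat !pos_ge; lra. Qed.

End cutoff.

Section integration_by_parts.
Context {R : realType}.
Implicit Types f g : R -> R.

(** In the variable [y = x / (n + 1)], the shift 4 places the rise on [-4, -2] and the shift -2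
    places the fall on [2, 4]. *)
Definition cutoff (n : nat) (x : R) :=
  step (n.+1%:R^-1 * x + 4) - step (n.+1%:R^-1 * x + (-2)).

Definition cutoff' (n : nat) (x : R) :=
  n.+1%:R^-1 * (hat (n.+1%:R^-1 * x + 4) - hat (n.+1%:R^-1 * x + (-2))).

Lemma cutoff_C1 n : C1 (cutoff n) (cutoff' n).
Proof.
have := C1B (C1_affine_comp n.+1%:R^-1 4 (@step_C1 R))
            (C1_affine_comp n.+1%:R^-1 (-2) (@step_C1 R)).
by congr C1; apply/funext => t; rewrite /cutoff' mulrBr.
Qed.

Lemma cutoff_norm n x : `|cutoff n x| <= 1.
Proof.
rewrite /cutoff; set a := step _; set b := step _.
have : 0 <= a <= 1 := step_bound _; have : 0 <= b <= 1 := step_bound _.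
by rewrite ler_norml; lra.
Qed.

Lemma cutoff'_norm n x : `|cutoff' n x| <= n.+1%:R^-1.
Proof.
rewrite /cutoff'; set a := hat _; set b := hat _.
have : 0 <= a <= 1 := hat_bound _; have : 0 <= b <= 1 := hat_bound _.
move=> b1 a1; rewrite normrM ger0_norm ?invr_ge0// ler_piMr ?invr_ge0//.
by rewrite ler_norml; lra.
Qed.

Lemma cutoff_supported n : supported (4 * n.+1%:R) (cutoff n).
Proof.
move=> x xn.
have : 4 < `|n.+1%:R^-1 * x| by rewrite normrM ger0_norm ?invr_ge0// ltr_pdivlMl// mulrC.
rewrite /cutoff; set y := _ * x.
rewrite lter_normr => /orP[y4|y4].
  by rewrite !step_ge2; lra.
by rewrite !step_le0; lra.
Qed.

Lemma cutoff_cvg x : cutoff n x @[n --> \oo] --> (1 : R).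
Proof.
apply: (@cvg_near_cst _ _ _ _ _ _ _).
near=> n.
have : `|n.+1%:R^-1 * x| <= 2.
  rewrite normrM ger0_norm ?invr_ge0// ler_pdivrMl//.
  have : `|x| <= n%:R by near: n; exact: nbhs_infty_ger.
  by have := normr_ge0 x; rewrite -natr1; lra.
rewrite /cutoff; set y := _ * x; rewrite ler_norml => y2.
by rewrite step_ge2 ?(step_le0 _) ?subr0//; lra.
Unshelve. all: by end_near. Qed.

(* Test against a cutoff equal to 1 on [-2n, 2n] whose derivative is O(1/n). *)
Lemma Int_derive0 f f' : C1 f f' -> 'intg f -> 'intg f' -> \int[leb]_x f' x = 0.
Proof.
move=> f1 intf intf'; have cf := C1_cont f1; have cf' := f1.2.
have cc n := C1_cont (@cutoff_C1 n); have cc' n := (@cutoff_C1 n).2.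
have intc n : 'intg (fun x => f' x * cutoff n x).
  apply: intg_le (integrable_norm intf') => [|x /=].
    by apply: measurable_funM; exact: cont_meas.
  by rewrite normrM ler_piMr// cutoff_norm.
have intc' n : 'intg (fun x => f x * cutoff' n x).
  apply: intg_le (integrable_norm intf) => [|x /=].
    by apply: measurable_funM; exact: cont_meas.
  by rewrite normrM ler_piMr// (le_trans (cutoff'_norm _ _))// invf_le1// ler1n.
have l1 : \int[leb]_x (f' x * cutoff n x) @[n --> \oo] --> \int[leb]_x f' x.
  apply: (@Int_dominated _ _ _ (fun x => `|f' x|)).
  - by move=> n; exact: intg_meas.
  - move=> x; rewrite -[X in _ --> X]mulr1; apply: cvgM; first exact: cvg_cst.
    exact: cutoff_cvg.
  - exact: (integrable_norm intf').
  - by move=> n x; rewrite normrM ler_piMr// cutoff_norm.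
have l2 : \int[leb]_x (f x * cutoff' n x) @[n --> \oo] --> (0 : R).
  apply: norm_cvg0.
  apply: (@squeeze_cvgr _ _ _ _ (cst 0) (fun n => n.+1%:R^-1 * \int[leb]_x `|f x|)).
  - apply: nearW => n; rewrite normr_ge0/=.
    rewrite -IntZ; last exact: (integrable_norm intf).
    rewrite (le_trans (le_normr_Rintegral _ (intc' n)))//.
    apply: Int_le.
    + exact: (integrable_norm (intc' n)).
    + by apply: intgZ; exact: (integrable_norm intf).
    + by move=> x; rewrite normrM mulrC ler_wpM2r// cutoff'_norm.
  - exact: cvg_cst.
  - rewrite -[X in _ --> X](mul0r (\int[leb]_x `|f x|)).
    exact: (cvgM cvg_harmonic (cvg_cst _)).
have E n : \int[leb]_x (f' x * cutoff n x) = - \int[leb]_x (f x * cutoff' n x).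
  apply/eqP; rewrite -addr_eq0 -IntD//; apply/eqP.
  apply: (@Int_derive_supported _ (4 * n.+1%:R) (fun x => f x * cutoff n x)).
    exact: C1M f1 (cutoff_C1 n).
  by move=> x /cutoff_supported ->; rewrite mulr0.
have l3 : (- \int[leb]_x (f x * cutoff' n x)) @[n --> \oo] --> (0 : R).
  by rewrite -oppr0; apply: cvgN; exact: l2.
move: l1; rewrite (_ : (fun n => _) = (fun n => - \int[leb]_x (f x * cutoff' n x))).
  by move=> l1; rewrite -(cvg_lim (@Rhausdorff R) l1) (cvg_lim (@Rhausdorff R) l3).
by apply/funext => n; exact: E.
Qed.

Lemma L2_ibp f f' g g' : C1 f f' -> C1 g g' ->
  L2 setT f -> L2 setT f' -> L2 setT g -> L2 setT g' ->
  \int[leb]_x (f' x * g x) = - \int[leb]_x (f x * g' x).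
Proof.
move=> f1 g1 f2 f2' g2 g2'.
apply/eqP; rewrite -addr_eq0 -IntD; [apply/eqP|exact: L2_mul|exact: L2_mul].
apply: (Int_derive0 (C1M f1 g1)); first exact: L2_mul.
by apply: intgD; exact: L2_mul.
Qed.

End integration_by_parts.

(** * Primitives and almost-everywhere equality *)

Section primitives.
Context {R : realType}.
Implicit Types f g F : R -> R.

Lemma L2loc_meas f : L2loc f -> measurable_fun setT f.
Proof.
move=> lf.
have : measurable_fun (\bigcup_n (`[- n%:R, n%:R]%classic : set (measurableTypeR R))) f.
  apply/measurable_fun_bigcup => n; first exact: measurable_itv.
  by case: (lf (- n%:R) n%:R).
rewrite (_ : \bigcup_n _ = setT)//.
exact: (@bigcup_itvT R true false).
Qed.

Lemma L2loc_sq f (a b : R) : L2loc f -> leb.-integrable `[a, b] (EFin \o (fun x => f x ^+ 2)).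
Proof.
move=> /(_ a b)[mf sqf]; apply/integrableP; split.
  by apply/measurable_EFinP; exact: measurable_funX.
by under eq_integral do rewrite /= ger0_norm ?sqr_ge0//.
Qed.

Lemma intg_cst_itv (a b k : R) : leb.-integrable `[a, b] (EFin \o cst k).
Proof. by apply: intg_cont_itv => x; exact: cst_continuous. Qed.

Lemma L2loc_intg f (a b : R) : L2loc f -> leb.-integrable `[a, b] (EFin \o f).
Proof.
move=> lf; have i : leb.-integrable `[a, b] ((EFin \o cst 1) \+ (EFin \o (fun x => f x ^+ 2))).
  by apply: integrableD; [exact: measurable_itv|exact: intg_cst_itv|exact: L2loc_sq].
apply: le_integrable i; first exact: measurable_itv.
  by apply/measurable_EFinP; case: (lf a b).
move=> x _ /=; rewrite lee_fin [leRHS]ger0_norm; last by rewrite addr_ge0// sqr_ge0.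
rewrite -(real_normK (num_real (f x))).
by have := sqr_ge0 (`|f x| - 1); have := normr_ge0 (f x); rewrite sqrrB; lra.
Qed.

(** Absolute continuity stated through increments: it makes sense for [f] known only almost
    everywhere, and leaves the constant of integration free. *)
Definition primitive F f : Prop :=
  forall a b : R, a <= b -> F b - F a = \int[leb]_(x in `[a, b]) f x.

Lemma Rintegral_split f (a b c : R) : L2loc f -> a <= b -> b <= c ->
  \int[leb]_(x in `[a, c]) f x =
  \int[leb]_(x in `[a, b]) f x + \int[leb]_(x in `[b, c]) f x.
Proof.
move=> lf ab bc; apply/eqP; rewrite addrC -subr_eq; apply/eqP.
rewrite Rintegral_itvB ?bnd_simp//; last exact: L2loc_intg.
rewrite Rintegral_itv_obnd_cbnd//.
apply: integrableS (L2loc_intg b c lf); [exact: measurable_itv|exact: measurable_itv|].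
exact: subset_itv_oc_cc.
Qed.

Lemma exists_primitive f : L2loc f -> exists F, primitive F f.
Proof.
move=> lf.
have z a : \int[leb]_(x in `[a, a]) f x = 0 by rewrite set_itv1 Rintegral_set1.
(* One of the two intervals is empty or a point, so this is the signed integral from 0 to [x]. *)
exists (fun x => \int[leb]_(t in `[0, x]) f t - \int[leb]_(t in `[x, 0]) f t).
have e a b : b < a -> \int[leb]_(x in `[a, b]) f x = 0.
  by move=> ba; rewrite set_itv_ge ?Rintegral_set0// bnd_simp -ltNge.
move=> a b ab; have [a0|a0] := leP 0 a.
  rewrite (Rintegral_split lf a0 ab).
  have [->|an0] := eqVneq a 0.
    have [->|bn0] := eqVneq b 0; first by rewrite !z; ring.
    by rewrite (e b 0) ?lt_def ?bn0 ?(le_trans a0 ab)// !z; ring.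
  have {an0}a0 : 0 < a by rewrite lt_def an0.
  by rewrite (e a 0)// (e b 0) ?(lt_le_trans a0 ab)//; ring.
have [b0|b0] := leP b 0.
  rewrite (Rintegral_split lf ab b0) (e 0 a)//.
  have [->|bn0] := eqVneq b 0; first by rewrite !z; ring.
  by rewrite (e 0 b) ?lt_def ?(eq_sym 0) ?bn0//; ring.
rewrite (Rintegral_split lf (ltW a0) (ltW b0)) (e 0 a)// (e b 0)//; ring.
Qed.

(** Pointwise [|f| <= d + f^2 / d]. The free parameter [d] lets this do the work of
    Cauchy-Schwarz. *)
Lemma primitive_osc F f (a b d : R) : L2loc f -> primitive F f -> a <= b -> 0 < d ->
  `|F b - F a| <= d * (b - a) + \int[leb]_(x in `[a, b]) (f x ^+ 2) / d.
Proof.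
move=> lf Ff ab d0; rewrite (Ff a b ab).
have i1 := L2loc_intg a b lf; have i2 := L2loc_sq a b lf.
have i3 : leb.-integrable `[a, b] (fun x => d^-1%:E * (f x ^+ 2)%:E)%E.
  by apply: integrableZl i2; exact: measurable_itv.
have i4 := intg_cst_itv a b d.
apply: (@le_trans _ _ (\int[leb]_(x in `[a, b]) `|f x|)).
  by apply: le_normr_Rintegral i1; exact: measurable_itv.
rewrite -RintegralZr//.
have <- : \int[leb]_(x in `[a, b]) cst d x = d * (b - a).
  rewrite Rintegral_cst//; congr (_ * _).
  have e : lebesgue_measure (`[a, b]%classic : set R) = (b - a)%:E.
    by rewrite lebesgue_measure_itv/= lte_fin; case: ltgtP ab => //= -> _; rewrite subrr.
  exact: (congr1 fine e).
have i5 : leb.-integrable `[a, b] (EFin \o (fun x => f x ^+ 2 / d)).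
  by apply: eq_integrable i3 => // x _; rewrite /= mulrC.
rewrite -RintegralD//; apply: le_Rintegral => //.
- exact: integrable_norm.
- by apply: integrableD i4 i5; exact: measurable_itv.
- move=> x _ /=; rewrite -(real_normK (num_real (f x))).
  rewrite -(ler_pM2r d0) mulrDl divfK ?gt_eqF//.
  have := sqr_ge0 (`|f x| - d); have := sqr_ge0 (`|f x|); have := sqr_ge0 d.
  by rewrite sqrrB; lra.
Qed.

End primitives.

Section almost_everywhere.
Context {R : realType}.
Implicit Types f g F : R -> R.

Lemma ae_imp (P Q : R -> Prop) : (forall x, P x -> Q x) ->
  (\forall x \ae @lebesgue_measure R, P x) -> \forall x \ae leb, Q x.
Proof.
move=> PQ; apply: filterS; first exact: (ae_filter_ringOfSetsType (@lebesgue_measure R)).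
exact: PQ.
Qed.

Lemma ae_imp2 (P Q S : R -> Prop) : (forall x, P x -> Q x -> S x) ->
  (\forall x \ae @lebesgue_measure R, P x) -> (\forall x \ae leb, Q x) ->
  \forall x \ae leb, S x.
Proof.
move=> PQS; apply: filterS2; first exact: (ae_filter_ringOfSetsType (@lebesgue_measure R)).
exact: PQS.
Qed.

(** Continuous functions that differ at a point differ on a ball, and a ball is not a null set. *)
Lemma cont_ae_eq f g : continuous f -> continuous g ->
  (\forall x \ae leb, f x = g x) -> forall x, f x = g x.
Proof.
move=> cf cg fg x; apply/eqP; rewrite -subr_eq0 -normr_le0 leNgt; apply/negP => d0.
have cfg : {for x, continuous (fun y => `|f y - g y|)}.
  apply: (continuous_comp (continuousB (cf x) (cg x))).
  exact: (@norm_continuous R R).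
have nb : nbhs x [set y | 0 < `|f y - g y|] by exact: (cvgr_gt _ cfg _ d0).
move/nbhs_ballP : nb => [r /= r0 ball_pos].
have [N [mN N0 subN]] := fg.
have ballN : ball x r `<=` N.
  move=> y /ball_pos fgy; apply: subN => /= e.
  by move: fgy => /=; rewrite e subrr normr0 ltxx.
have : (lebesgue_measure (ball x r) <= lebesgue_measure N)%E.
  by apply: le_measure => //; rewrite inE; [exact: measurable_ball|exact: mN].
rewrite lebesgue_measure_ball ?(ltW r0)//.
move=> h; have {}h := le_trans h (eq_ind _ (fun z => (z <= 0)%E) (lexx 0%E) _ (esym N0)).
by move: h; rewrite lee_fin leNgt pmulrn_lgt0 ?r0.
Qed.

Lemma L2_ae f F : measurable_fun setT F -> (\forall x \ae leb, f x = F x) ->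
  L2 setT f -> L2 setT F.
Proof.
move=> mF fF [mf sqf]; split=> //.
rewrite -(@ae_eq_integral _ _ _ leb setT _ (fun x => (f x ^+ 2)%:E))//.
- by apply/measurable_EFinP; exact: measurable_funX.
- by apply/measurable_EFinP; exact: measurable_funX.
- by apply: ae_imp fF => x /= -> _.
Qed.

Lemma Rintegral_ae_eq (D : set R) f g : measurable D -> measurable_fun D f ->
  measurable_fun D g -> (\forall x \ae leb, f x = g x) ->
  \int[leb]_(x in D) f x = \int[leb]_(x in D) g x.
Proof.
move=> mD mf mg fg; rewrite /Rintegral; congr fine.
apply: ae_eq_integral => //; [exact/measurable_EFinP|exact/measurable_EFinP|].
by apply: ae_imp fg => x /= -> _.
Qed.

Lemma Rint_subset (A B : set R) f : measurable A -> measurable B -> A `<=` B ->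
  (forall x, 0 <= f x) -> leb.-integrable B (EFin \o f) ->
  \int[leb]_(x in A) f x <= \int[leb]_(x in B) f x.
Proof.
move=> mA mB AB f0 iB.
have iA : leb.-integrable A (EFin \o f) by apply: integrableS iB.
rewrite [leLHS]Rintegral_mkcond [leRHS]Rintegral_mkcond.
apply: Int_le.
- by move/integrable_mkcond : iA => /(_ mA); rewrite restrict_EFin.
- by move/integrable_mkcond : iB => /(_ mB); rewrite restrict_EFin.
- move=> x; rewrite !patchE; case: ifPn => xA; case: ifPn => xB //.
  by move: xB; rewrite notin_setE => /(_ (AB _ (set_mem xA))).
Qed.

Lemma primitive_cont F f : L2loc f -> primitive F f -> continuous F.
Proof.
move=> lf Ff x; apply/cvgrPdist_le => e e0.
pose I := \int[leb]_(t in `[x - 1, x + 1]) (f t ^+ 2).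
have I0 : 0 <= I by apply: Rintegral_ge0 => t _; exact: sqr_ge0.
(* Makes the term [I / d] of [primitive_osc] at most [e / 2]; the linear term is then at most
   [e / 2] for points within [e / (2 d)] of each other. *)
pose d := 2 * (I + 1) / e.
have d0 : 0 < d by rewrite divr_gt0// mulr_gt0// ltr_wpDl.
have Id : I / d <= e / 2.
  rewrite ler_pdivrMr// /d mulrC mulrA divfK ?gt_eqF//; lra.
have osc a b : a <= b -> x - 1 <= a -> b <= x + 1 -> b - a <= e / (2 * d) ->
    `|F b - F a| <= e.
  move=> ab xa bx ba; apply: (le_trans (primitive_osc lf Ff ab d0)).
  have h1 : \int[leb]_(t in `[a, b]) (f t ^+ 2) / d <= I / d.
    rewrite ler_wpM2r ?invr_ge0 ?(ltW d0)//; apply: Rint_subset.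
    - exact: measurable_itv.
    - exact: measurable_itv.
    - by apply: subset_itv; rewrite bnd_simp.
    - by move=> t; exact: sqr_ge0.
    - exact: L2loc_sq.
  have h2 : d * (b - a) <= e / 2.
    by rewrite -ler_pdivlMl// (le_trans ba)// invfM mulrA mulrC.
  lra.
near=> y.
have yx : `|x - y| <= 1.
  by near: y; apply: (@cvgr_dist_le _ _ _ _ _ id) => //; exact: cvg_id.
have yx' : `|x - y| <= e / (2 * d).
  near: y; apply: (@cvgr_dist_le _ _ _ _ _ id); first exact: cvg_id.
  by rewrite divr_gt0// mulr_gt0.
have [xy|/ltW xy] := leP x y.
  rewrite distrC; apply: osc => //; first lra.
    by move: yx; rewrite distrC ger0_norm; lra.
  by move: yx'; rewrite distrC ger0_norm; lra.
apply: osc => //; last 2 first.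
- lra.
- by move: yx'; rewrite ger0_norm; lra.
- by move: yx; rewrite ger0_norm; lra.
Unshelve. all: by end_near. Qed.

(** The increments of [F] are also integrals of the continuous representative [g], to which the
    fundamental theorem applies on a neighbourhood of each point. *)
Lemma primitive_C1 F f g : L2loc f -> primitive F f -> continuous g ->
  (\forall x \ae leb, f x = g x) -> C1 F g.
Proof.
move=> lf Ff cg fg; split=> // x.
have x1 : x < x + 1 by lra. have x2 : x - 1 < x by lra.
have [der val] := @continuous_FTC1_closed _ g (x - 1) x (x + 1) x1
  (intg_cont_itv _ _ cg) x2 (cg x).
have dG := derive1_dv der; rewrite val in dG.
have := dvD (is_derive_cst (F (x - 1)) x 1) dG.
rewrite add0r; apply: near_eq_is_derive.
near=> y.
have xy : x - 1 <= y.
  have : `|x - y| <= 1.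
    by near: y; apply: (@cvgr_dist_le _ _ _ _ _ id) => //; exact: cvg_id.
  by rewrite ler_norml; lra.
rewrite -[RHS](subrK (F (x - 1))) (Ff _ _ xy) addrC; congr (_ + _).
symmetry; apply: Rintegral_ae_eq fg.
- exact: measurable_itv.
- by apply: measurable_funTS; exact: L2loc_meas.
- by apply: measurable_funTS; exact: cont_meas.
Unshelve. all: by end_near. Qed.

End almost_everywhere.

(** * Absolute continuity of weakly derivable functions *)

Section weak_derivatives.
Context {R : realType}.
Implicit Types f g F : R -> R.

Lemma intg_loc_mul r f g : L2loc f -> continuous g -> supported r g ->
  'intg (fun x => f x * g x).
Proof.
move=> lf cg gr; apply: (@intg_supported _ r).
  by move=> x /gr ->; rewrite mulr0.
have i1 := L2loc_sq (- r) r lf.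
have i2 : leb.-integrable `[- r, r] (EFin \o (fun x => g x ^+ 2)).
  by apply: intg_cont_itv => x; exact: (continuousM (cg x) (cg x)).
have i : leb.-integrable `[- r, r]
    ((EFin \o (fun x => f x ^+ 2)) \+ (EFin \o (fun x => g x ^+ 2))).
  by apply: integrableD i1 i2; exact: measurable_itv.
apply: le_integrable i; first exact: measurable_itv.
  apply/measurable_EFinP/measurable_funTS/measurable_funM; first exact: L2loc_meas.
  exact: cont_meas.
move=> x _ /=; rewrite lee_fin [leRHS]ger0_norm ?addr_ge0 ?sqr_ge0// normrM.
rewrite -(real_normK (num_real (f x))) -(real_normK (num_real (g x))).
have := sqr_ge0 (`|f x| - `|g x|); have := sqr_ge0 (`|f x|); have := sqr_ge0 (`|g x|).
by rewrite sqrrB; lra.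
Qed.

(** [khat n x] is a one-sided approximate identity at [x]: nonnegative, of integral 1, and zero
    outside [x, x + 2/(n+1)]. [kstep n x] is its primitive, a regularised jump at [x]. *)
Definition kstep (n : nat) (x t : R) := step (n.+1%:R * t + - (n.+1%:R * x)).
Definition khat (n : nat) (x t : R) :=
  n.+1%:R * hat (n.+1%:R * t + - (n.+1%:R * x)).

Lemma kstep_C1 n x : C1 (kstep n x) (khat n x).
Proof. exact: C1_affine_comp (@step_C1 R). Qed.

Lemma khat_cont n x : continuous (khat n x).
Proof. exact: (kstep_C1 n x).2. Qed.

Lemma khat_bound n x t : 0 <= khat n x t <= n.+1%:R.
Proof.
have /andP[h0 h1] := hat_bound (n.+1%:R * t + - (n.+1%:R * x)).
by rewrite /khat mulr_ge0//= ler_piMr.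
Qed.

Lemma khat_ball n x t : ~ ball x (2 / n.+1%:R) t -> khat n x t = 0.
Proof.
move=> xt; have {}xt : 2 <= n.+1%:R * `|x - t|.
  by rewrite -ler_pdivrMl// mulrC leNgt; apply/negP.
rewrite /khat -mulrBr; have [h|/ltW h] := leP x t.
  rewrite hat_ge2 ?mulr0//; move: xt; rewrite ler0_norm; last by rewrite subr_le0.
  by rewrite opprB.
rewrite hat_le0 ?mulr0//.
by rewrite mulr_ge0_le0// subr_le0.
Qed.

Lemma kstep_ge n x t : x + 2 / n.+1%:R <= t -> kstep n x t = 1.
Proof.
move=> xt; rewrite /kstep -mulrBr step_ge2// mulrC -ler_pdivrMr//.
by rewrite lerBrDl.
Qed.

Lemma kstep_le n x t : t <= x -> kstep n x t = 0.
Proof. by move=> tx; rewrite /kstep -mulrBr step_le0// mulr_ge0_le0// subr_le0. Qed.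

Lemma khat_supported n x : supported (`|x| + 2) (khat n x).
Proof.
move=> t xt; apply: khat_ball; rewrite /ball/= => b.
have : `|t| <= `|x| + `|x - t|.
  by rewrite -[X in `|X| <= _](subKr x) (le_trans (ler_normB _ _)).
apply/negP; rewrite -ltNge (le_lt_trans _ xt)// lerD2l (le_trans (ltW b))//.
by rewrite ler_pdivrMr// ler_peMr// ler1n.
Qed.

Lemma Int_khat n x : \int[leb]_t khat n x t = 1.
Proof.
rewrite (Int_supported (@khat_supported n x)) (C1_FTC (kstep_C1 n x)); last first.
  by have := normr_ge0 x; lra.
have := ler_norm x; have := ler_norm (- x); rewrite normrN => h1 h2.
rewrite kstep_ge; last first.
  by rewrite lerD// ler_pdivrMr// ler_peMr// ler1n.
by rewrite kstep_le ?subr0//; lra.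
Qed.

Lemma L2loc_ball f (x r : R) : L2loc f -> leb.-integrable (ball x r) (EFin \o f).
Proof.
move=> lf; apply: integrableS (L2loc_intg (x - r) (x + r) lf).
- exact: measurable_itv.
- exact: measurable_ball.
- move=> y; rewrite /ball/= in_itv/= => /ltW; rewrite ler_norml => h.
  by apply/andP; split; lra.
Qed.

Lemma L2loc_cst (c : R) : L2loc (fun _ : R => c).
Proof.
move=> a b; split; first exact: measurable_cst.
have := intg_cst_itv a b (c ^+ 2); move/integrable_lty; apply.
exact: measurable_itv.
Qed.

Lemma davgE f (x r : R) : L2loc f -> 0 < r ->
  davg f x r = ((r *+ 2)^-1 * \int[leb]_(y in ball x r) `|f y - f x|)%:E.
Proof.
move=> lf r0; rewrite /davg /iavg EFinM; congr (_ * _)%E.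
  rewrite lebesgue_measure_ball ?(ltW r0)// inver mulrn_eq0/= gt_eqF//.
rewrite /Rintegral fineK//; apply: integrable_fin_num; first exact: measurable_ball.
apply: (@integrable_norm _ _ _ leb _ (fun y => f y - f x)).
have i1 := L2loc_ball x r lf; have i2 := L2loc_ball x r (L2loc_cst (f x)).
by apply: integrableB i1 i2; exact: measurable_ball.
Qed.

(** The kernel is at most [n + 1] and vanishes off a ball of measure [4 / (n + 1)], so the error is
    at most 4 times the mean oscillation of [f] over that ball, which tends to 0 at a Lebesgue
    point. *)
Lemma khat_cvg f x : L2loc f -> lebesgue_pt f x ->
  \int[leb]_t (f t * khat n x t) @[n --> \oo] --> f x.
Proof.
move=> lf fx.
have ik n : 'intg (khat n x).
  apply: intg_cont_supported (@khat_supported n x); exact: khat_cont.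
have ifk n : 'intg (fun t => f t * khat n x t).
  by apply: intg_loc_mul lf (@khat_cont n x) (@khat_supported n x).
pose I r := \int[leb]_(y in ball x r) `|f y - f x|.
have bound n : `|\int[leb]_t (f t * khat n x t) - f x| <=
    4 * fine (davg f x (2 / n.+1%:R)).
  rewrite davgE ?divr_gt0//= -/(I _).
  have -> : 4 * ((2 / n.+1%:R *+ 2)^-1 * I (2 / n.+1%:R)) = n.+1%:R * I (2 / n.+1%:R).
    by rewrite -mulr_natr; field; rewrite addrC natr1 pnatr_eq0.
  have -> : \int[leb]_t (f t * khat n x t) - f x =
      \int[leb]_t ((f t - f x) * khat n x t).
    rewrite -[X in _ - X]mulr1 -(Int_khat n x) -IntZ// -IntB//; last exact: intgZ.
    by apply: eq_Rintegral => t _; rewrite mulrBl.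
  have i : 'intg (fun t => (f t - f x) * khat n x t).
    by under eq_fun do rewrite mulrBl; apply: intgB => //; exact: intgZ.
  apply: (le_trans (le_normr_Rintegral measurableT i)).
  have ib : leb.-integrable (ball x (2 / n.+1%:R)) (EFin \o (fun y => `|f y - f x|)).
    apply: (@integrable_norm _ _ _ leb _ (fun y => f y - f x)).
    have i1 := L2loc_ball x (2 / n.+1%:R) lf.
    have i2 := L2loc_ball x (2 / n.+1%:R) (L2loc_cst (f x)).
    by apply: integrableB i1 i2; exact: measurable_ball.
  have mb := measurable_ball x (2 / n.+1%:R).
  rewrite /I -RintegralZl// [leRHS]Rintegral_mkcond; apply: Int_le.
  - exact: integrable_norm.
  - have : leb.-integrable (ball x (2 / n.+1%:R)) (fun y => n.+1%:R%:E * `|f y - f x|%:E)%E.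
      by apply: integrableZl ib; exact: measurable_ball.
    by move/integrable_mkcond => /(_ mb); rewrite -restrict_EFin.
  - move=> t; rewrite patchE; case: ifPn => xt.
      have /andP[k0 k1] := khat_bound n x t.
      by rewrite normrM (ger0_norm k0) mulrC ler_wpM2r.
    by rewrite khat_ball ?mulr0 ?normr0//; move: xt; rewrite notin_setE.
have fine0 : fine (davg f x r) @[r --> 0^'+] --> (0 : R).
  by apply: fine_cvg; exact: fx.
have l0 : fine (davg f x (2 / n.+1%:R)) @[n --> \oo] --> (0 : R).
  move/cvg_at_rightP : fine0; apply; split; first by move=> n; rewrite divr_gt0.
  rewrite -[X in _ --> X](mulr0 2); apply: (cvgM (cvg_cst _)).
  exact: cvg_harmonic.
apply/cvgrPdist_le => e e0; near=> n.
rewrite distrC (le_trans (bound n))//.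
have : `|0 - fine (davg f x (2 / n.+1%:R))| <= e / 4.
  by near: n; move/cvgrPdist_le : l0; apply; rewrite divr_gt0.
by rewrite sub0r normrN ler_norml; lra.
Unshelve. all: by end_near. Qed.

Lemma L2loc_locally_integrable f : L2loc f -> locally_integrable setT f.
Proof.
move=> lf; split; [exact: L2loc_meas|exact: openT|move=> K _ cK].
have [r rK] : exists r : R, K `<=` `[- r, r]%classic.
  have [M [_ MK]] := compact_bounded cK.
  exists (M + 1) => x Kx; rewrite /= in_itv/= -ler_norml.
  by apply: (MK (M + 1)) => //; rewrite ltrDl.
have mK : measurable (K : set (measurableTypeR R)) by exact: compact_measurable.
have /integrable_norm/integrableP[_] : leb.-integrable K (EFin \o f).
  by apply: integrableS (L2loc_intg (- r) r lf) => //; exact: measurable_itv.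
by under eq_integral do rewrite /= normr_id.
Qed.

Lemma test_function_C1 (r : R) (phi phi' : R -> R) : C1 phi phi' -> supported r phi ->
  test_function phi /\ phi^`()%classic = phi'.
Proof.
move=> [dphi cphi] sphi.
have e : phi^`()%classic = phi' by apply/funext => x; exact: dv_derive1.
split=> //; split; last by exists r.
  by move=> x; case: (dphi x).
by rewrite e.
Qed.

Lemma near_two_div (d : R) : 0 < d -> \forall n \near \oo, 2 / n.+1%:R <= d.
Proof.
move=> d0; near=> n; rewrite ler_pdivrMr// -ler_pdivrMl//.
have : d^-1 * 2 <= n%:R by near: n; exact: nbhs_infty_ger.
by rewrite -natr1; lra.
Unshelve. all: by end_near. Qed.

(* Test against [kstep n x - kstep n y], whose derivative is a difference of
   approximate identities at [x] and [y]. *)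
Lemma weak_increment f f' (x y : R) : L2loc f -> L2loc f' ->
  weak_derivative f f' -> lebesgue_pt f x -> lebesgue_pt f y -> x < y ->
  f y - f x = \int[leb]_(t in `[x, y]) f' t.
Proof.
move=> lf lf' wd fx fy xy.
pose phi n t := kstep n x t - kstep n y t.
pose phi' n t := khat n x t - khat n y t.
have phi1 n : C1 (phi n) (phi' n) by exact: C1B (kstep_C1 n x) (kstep_C1 n y).
have two n : 2 / n.+1%:R <= 2 :> R by rewrite ler_pdivrMr// ler_peMr// ler1n.
have phi_out n t : ~~ (x <= t <= y + 2) -> phi n t = 0.
  rewrite negb_and -!ltNge /phi => /orP[tx|yt].
    by rewrite !kstep_le ?subrr// ?ltW// (lt_trans tx).
  rewrite !kstep_ge ?subrr//; have := two n; move: (2 / _) => q; lra.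
have phi_supp n : supported (`|x| + `|y| + 2) (phi n).
  move=> t rt; apply: phi_out; apply/negP => /andP[xt ty].
  move: rt; apply/negP; rewrite -leNgt ler_norml.
  have := ler_norm y; have := ler_norm (- x); have := normr_ge0 x; have := normr_ge0 y.
  by rewrite normrN => *; apply/andP; split; lra.
have eqn n : \int[leb]_t (f t * khat n x t) - \int[leb]_t (f t * khat n y t)
    = - \int[leb]_t (f' t * phi n t).
  have [tphi ephi] := test_function_C1 (phi1 n) (@phi_supp n).
  rewrite -(wd _ tphi) ephi -IntB.
  - by apply: eq_Rintegral => t _; rewrite mulrBr.
  - by apply: intg_loc_mul lf (@khat_cont n x) (@khat_supported n x).
  - by apply: intg_loc_mul lf (@khat_cont n y) (@khat_supported n y).
have lim1 := cvgB (khat_cvg lf fx) (khat_cvg lf fy).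
(* Each [kstep] rises to the right of its base point, so the limit is 0 at [x] and 1 at [y]: the
   interval is half-open. *)
have ind_cvg t : phi n t @[n --> \oo] --> (\1_(`]x, y]%classic : set R) t : R).
  rewrite indicE; case: (boolP (t \in _)) => [|].
    rewrite inE/= in_itv/= => /andP[xt ty]; apply: (@cvg_near_cst _ _ _ _ _ _ _).
    near=> n; rewrite /phi (kstep_le _ ty) subr0 kstep_ge//.
    by rewrite -lerBrDl; near: n; apply: near_two_div; rewrite subr_gt0.
  rewrite notin_setE/= in_itv/= => /negP; rewrite negb_and -!ltNge -leNgt => /orP[tx|yt].
    apply: (@cvg_near_cst _ _ _ _ _ _ _); apply: nearW => n.
    by rewrite /phi !kstep_le ?subrr// (le_trans tx)// ltW.
  apply: (@cvg_near_cst _ _ _ _ _ _ _); near=> n.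
  have yn : y + 2 / n.+1%:R <= t.
    by rewrite -lerBrDl; near: n; apply: near_two_div; rewrite subr_gt0.
  by rewrite /phi !kstep_ge ?subrr// (le_trans _ yn)// lerD2r ltW.
have mphi n : measurable_fun setT (phi n) := cont_meas (C1_cont (phi1 n)).
have lim2 : \int[leb]_t (f' t * phi n t) @[n --> \oo] -->
    \int[leb]_t (f' t * \1_(`]x, y]%classic : set R) t).
  (* The widest transition, for [n = 0], has width 2; hence every [phi n] vanishes outside
     [x, y + 2]. *)
  have ig : leb.-integrable `[x, y + 2] (EFin \o (fun t => `|f' t|)).
    by apply: integrable_norm; exact: L2loc_intg.
  apply: (@Int_dominated _ _ _ (fun t => ((fun t => `|f' t|) \_ `[x, y + 2]) t)).
  - by move=> n; apply: measurable_funM => //; exact: L2loc_meas.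
  - by move=> t; apply: (cvgM (cvg_cst _)); exact: ind_cvg.
  - by move/integrable_mkcond : ig => /(_ (measurable_itv _)); rewrite restrict_EFin.
  - move=> n t; rewrite patchE; case: ifPn => [_|].
      rewrite normrM ler_piMr// /phi /kstep ler_norml.
      set a := step _; set b := step _.
      have : 0 <= a <= 1 := step_bound _; have : 0 <= b <= 1 := step_bound _.
      lra.
    by rewrite notin_setE/= in_itv/= => /negP /phi_out ->; rewrite mulr0 normr0.
have -> : \int[leb]_(t in `[x, y]) f' t = \int[leb]_t (f' t * \1_(`]x, y]%classic : set R) t).
  rewrite -Rintegral_itv_obnd_cbnd; last first.
    apply: integrableS (L2loc_intg x y lf'); [exact: measurable_itv|exact: measurable_itv|].
    exact: subset_itv_oc_cc.
  rewrite Rintegral_mkcond; apply: eq_Rintegral => t _.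
  by rewrite patchE indicE; case: ifPn => _; rewrite ?mulr1 ?mulr0.
have e : (fun n => \int[leb]_t (f t * khat n x t) - \int[leb]_t (f t * khat n y t))
    = (fun n => - \int[leb]_t (f' t * phi n t)) by apply/funext => n; exact: eqn.
have {}lim1 : (- \int[leb]_t (f' t * phi n t)) @[n --> \oo] --> f x - f y.
  by rewrite -e; exact: lim1.
have lim4 : (- \int[leb]_t (f' t * phi n t)) @[n --> \oo] -->
    - \int[leb]_t (f' t * \1_(`]x, y]%classic : set R) t) by apply: cvgN; exact: lim2.
have := cvg_lim (@Rhausdorff R) lim1; rewrite (cvg_lim (@Rhausdorff R) lim4).
by move=> e1; rewrite -[LHS]opprB -e1 opprK.
Unshelve. all: by end_near. Qed.

Lemma weak_primitive f f' : L2loc f -> L2loc f' -> weak_derivative f f' ->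
  exists F, primitive F f' /\ \forall x \ae leb, f x = F x.
Proof.
move=> lf lf' wd; have [F0 F0f'] := exists_primitive lf'.
have pts := lebesgue_differentiation (L2loc_locally_integrable lf).
(* A base point that fixes the constant of integration; it exists because [0, 1] is not contained in
   a null set. *)
have [x0 fx0] : exists x0, lebesgue_pt f x0.
  have [N [mN N0 subN]] := pts.
  apply: contrapT => /forallNP nopt.
  have : (lebesgue_measure (`[0%R, 1%R]%classic : set R) <= lebesgue_measure N)%E.
    apply: le_measure; rewrite ?inE; [exact: measurable_itv|exact: mN|].
    by move=> x _; apply: subN; exact: nopt.
  rewrite lebesgue_measure_itv/= lte_fin ltr01.
  move=> h; have {}h := le_trans h (eq_ind _ (fun z => (z <= 0)%E) (lexx 0%E) _ (esym N0)).
  by move: h; rewrite oppr0 adde0 lee_fin ler10.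
exists (fun x => F0 x - F0 x0 + f x0); split.
  by move=> a b ab; rewrite -(F0f' a b ab); ring.
apply: ae_imp pts => x fx.
have [xx0|x0x|->] := ltgtP x x0.
- by have := weak_increment lf lf' wd fx fx0 xx0; rewrite -(F0f' _ _ (ltW xx0)); lra.
- by have := weak_increment lf lf' wd fx0 fx x0x; rewrite -(F0f' _ _ (ltW x0x)); lra.
- lra.
Qed.

End weak_derivatives.

(** * Products and sums of weak derivatives *)

Section weak_calculus.
Context {R : realType}.
Implicit Types f g c : R -> R.

Lemma wderivP f : weakly_derivable f -> L2loc (wderiv f) /\ weak_derivative f (wderiv f).
Proof. by move=> wf; exact: (xgetPex (fun=> 0) wf). Qed.

Lemma weak_rep f : L2loc f -> weakly_derivable f ->
  exists F, primitive F (wderiv f) /\ \forall x \ae leb, f x = F x.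
Proof. by move=> lf /wderivP[lf' wf]; exact: weak_primitive. Qed.

Lemma cont_bounded_itv c (a b : R) : continuous c ->
  exists K : R, forall x, a <= x <= b -> `|c x| <= K.
Proof.
move=> cc; have : compact (c @` `[a, b]).
  by apply: continuous_compact; [exact: continuous_subspaceT|exact: segment_compact].
move/compact_bounded => [M [_ MK]]; exists (M + 1) => x xab.
by apply: (MK (M + 1)); [rewrite ltrDl|exists x => //; rewrite /= in_itv].
Qed.

Lemma L2loc_mulc c f : continuous c -> L2loc f -> L2loc (fun x => c x * f x).
Proof.
move=> cc lf a b.
have mcf : measurable_fun `[a, b] (fun x => c x * f x).
  by apply: measurable_funTS; apply: measurable_funM; [exact: cont_meas|exact: L2loc_meas].
split=> //; have [K cK] := cont_bounded_itv a b cc.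
have i : leb.-integrable `[a, b] (fun x => (K ^+ 2)%:E * (f x ^+ 2)%:E)%E.
  by apply: integrableZl (L2loc_sq a b lf); exact: measurable_itv.
have : leb.-integrable `[a, b] (EFin \o (fun x => (c x * f x) ^+ 2)).
  apply: le_integrable i; first exact: measurable_itv.
    by apply/measurable_EFinP; exact: measurable_funX.
  move=> x; rewrite /= in_itv/= => xab; rewrite lee_fin [leRHS]ger0_norm; last first.
    by apply: mulr_ge0; exact: sqr_ge0.
  rewrite ger0_norm ?sqr_ge0// exprMn ler_wpM2r ?sqr_ge0//.
  have K0 : 0 <= K := le_trans (normr_ge0 _) (cK x xab).
  rewrite -(real_normK (num_real (c x))).
  by apply: lerXn2r; [exact: normr_ge0|exact: K0|exact: cK].
by move/integrable_lty; apply; exact: measurable_itv.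
Qed.

Lemma L2locD f g : L2loc f -> L2loc g -> L2loc (fun x => f x + g x).
Proof.
move=> lf lg a b.
have mfg : measurable_fun `[a, b] (fun x => f x + g x).
  by apply: measurable_funTS; apply: measurable_funD; exact: L2loc_meas.
split=> //.
have i1 : leb.-integrable `[a, b] (fun x => (2)%:E * (f x ^+ 2)%:E)%E.
  by apply: integrableZl (L2loc_sq a b lf); exact: measurable_itv.
have i2 : leb.-integrable `[a, b] (fun x => (2)%:E * (g x ^+ 2)%:E)%E.
  by apply: integrableZl (L2loc_sq a b lg); exact: measurable_itv.
have i : leb.-integrable `[a, b]
    ((fun x => 2%:E * (f x ^+ 2)%:E) \+ (fun x => 2%:E * (g x ^+ 2)%:E))%E.
  by apply: integrableD i1 i2; exact: measurable_itv.
have : leb.-integrable `[a, b] (EFin \o (fun x => (f x + g x) ^+ 2)).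
  apply: le_integrable i; first exact: measurable_itv.
    by apply/measurable_EFinP; exact: measurable_funX.
  move=> x _ /=; rewrite lee_fin [leRHS]ger0_norm; last first.
    by apply: addr_ge0; apply: mulr_ge0 => //; exact: sqr_ge0.
  rewrite ger0_norm ?sqr_ge0//.
  by have := sqr_ge0 (f x - g x); rewrite sqrrB sqrrD; lra.
by move/integrable_lty; apply; exact: measurable_itv.
Qed.

Lemma L2_L2loc f : L2 setT f -> L2loc f.
Proof.
move=> f2 a b; have i := L2_sq f2.
split; first by apply: measurable_funTS; exact: L2_meas.
have : leb.-integrable `[a, b] (EFin \o (fun x => f x ^+ 2)).
  by apply: integrableS i => //; exact: measurable_itv.
by move/integrable_lty; apply; exact: measurable_itv.
Qed.

Lemma test_C1 (phi : R -> R) : test_function phi ->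
  C1 phi (phi^`()%classic) /\ exists r, supported r phi.
Proof.
move=> [dphi cphi sphi]; split; last exact: sphi.
by split; [move=> x; exact: derive1_dv|exact: cphi].
Qed.

(** The factor [c] is moved onto the test function: as test functions are only C^1, [c phi] is again
    one. *)
Lemma wd_mulc c c' f f' : C1 c c' -> L2loc f -> L2loc f' -> weak_derivative f f' ->
  weak_derivative (fun x => c x * f x) (fun x => c' x * f x + c x * f' x).
Proof.
move=> c1 lf lf' wf phi /test_C1[phi1 [r sphi]].
have sphi' := supported_derive phi1 sphi.
have cc := C1_cont c1; have cphi := C1_cont phi1.
have s1 : supported r (fun x => c x * phi x) by move=> x /sphi ->; rewrite mulr0.
have [t1 e1] := test_function_C1 (C1M c1 phi1) s1.
have := wf _ t1; rewrite e1 => eqn.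
have i1 : 'intg (fun x => f x * (c' x * phi x)).
  apply: (@intg_loc_mul _ r) => // [x|x /sphi ->]; last by rewrite mulr0.
  exact: (continuousM (c1.2 x) (cphi x)).
have i2 : 'intg (fun x => f x * (c x * phi^`()%classic x)).
  apply: (@intg_loc_mul _ r) => // [x|x /sphi' ->]; last by rewrite mulr0.
  exact: (continuousM (cc x) (phi1.2 x)).
have i3 : 'intg (fun x => f' x * (c x * phi x)).
  apply: (@intg_loc_mul _ r) => // x; exact: (continuousM (cc x) (cphi x)).
have e2 : \int[leb]_x (f x * (c' x * phi x + c x * phi^`()%classic x)) =
   \int[leb]_x (f x * (c' x * phi x)) + \int[leb]_x (f x * (c x * phi^`()%classic x)).
  by rewrite -IntD//; apply: eq_Rintegral => x _; rewrite mulrDr.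
have e3 : \int[leb]_x ((c' x * f x + c x * f' x) * phi x) =
   \int[leb]_x (f x * (c' x * phi x)) + \int[leb]_x (f' x * (c x * phi x)).
  by rewrite -IntD//; apply: eq_Rintegral => x _; ring.
have e4 : \int[leb]_x (c x * f x * phi^`()%classic x) =
   \int[leb]_x (f x * (c x * phi^`()%classic x)).
  by apply: eq_Rintegral => x _; ring.
rewrite e3 e4; move: eqn; rewrite e2 => /eqP.
by rewrite addrC eq_sym -subr_eq => /eqP <-; ring.
Qed.

Lemma wdD f f' g g' : L2loc f -> L2loc f' -> L2loc g -> L2loc g' ->
  weak_derivative f f' -> weak_derivative g g' ->
  weak_derivative (fun x => f x + g x) (fun x => f' x + g' x).
Proof.
move=> lf lf' lg lg' wf wg phi tphi; have [phi1 [r sphi]] := test_C1 tphi.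
have sphi' := supported_derive phi1 sphi; have cphi := C1_cont phi1.
have i k : L2loc k -> 'intg (fun x => k x * phi x) by move=> lk; exact: (@intg_loc_mul _ r).
have i' k : L2loc k -> 'intg (fun x => k x * phi^`()%classic x).
  by move=> lk; apply: (@intg_loc_mul _ r) => //; exact: phi1.2.
under eq_Rintegral do rewrite mulrDl.
under [in RHS]eq_Rintegral do rewrite mulrDl.
rewrite !IntD ?(wf _ tphi) ?(wg _ tphi) ?opprD//; by [exact: i|exact: i'].
Qed.

Lemma weakly_derivableD f g : L2loc f -> L2loc g -> weakly_derivable f ->
  weakly_derivable g -> weakly_derivable (fun x => f x + g x).
Proof.
move=> lf lg [f' [lf' wf]] [g' [lg' wg]]; exists (fun x => f' x + g' x).
by split; [exact: L2locD|exact: wdD].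
Qed.

Lemma weakly_derivable_mulc c c' f : C1 c c' -> L2loc f -> weakly_derivable f ->
  weakly_derivable (fun x => c x * f x).
Proof.
move=> c1 lf [f' [lf' wf]]; exists (fun x => c' x * f x + c x * f' x).
split; last exact: wd_mulc.
by apply: L2locD; apply: L2loc_mulc => //; [exact: c1.2|exact: C1_cont c1].
Qed.

End weak_calculus.

(** * Regularity of stationary solutions *)

Section regularity.
Context {R : realType}.

Lemma C1V (f f' : R -> R) : C1 f f' -> (forall x, f x != 0) ->
  C1 (fun x => (f x)^-1) (fun x => - f' x / f x ^+ 2).
Proof.
move=> f1 f0; have cf := C1_cont f1; split=> x.
  apply: is_derive_eq (is_deriveV (f0 x) (f1.1 x)) _.
  by rewrite /GRing.scale/= mulNr mulNr mulrC.
have cn : {for x, continuous (fun x => - f' x)} by apply: continuousN; exact: f1.2.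
have ci : {for x, continuous (fun x => (f x ^+ 2)^-1)}.
  apply: continuousV; first by rewrite expf_neq0.
  exact: (continuousM (cf x) (cf x)).
exact: (continuousM cn ci).
Qed.

Lemma C1_cst (c : R) : C1 (fun _ : R => c) (fun _ => 0).
Proof. by split=> x; [exact: is_derive_cst|exact: cst_continuous]. Qed.

Lemma C1_eq (f f' g g' : R -> R) : C1 f f' -> (forall x, f x = g x) ->
  (forall x, f' x = g' x) -> C1 g g'.
Proof. by move=> f1 /funext <- /funext <-. Qed.

(* Second derivative of the Gibbs energy: [h ^ 3 * gibbs h = h ^ 2 / (1 + h) ^ 2]. *)
Definition gibbs (h : R) := (h * (1 + h) ^+ 2)^-1.
Definition gibbs' (h : R) := - (1 + 3 * h) / (h ^+ 2 * (1 + h) ^+ 3).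

Lemma C1_gibbs (h h1 : R -> R) : C1 h h1 -> (forall x, 0 < h x) ->
  C1 (fun x => gibbs (h x)) (fun x => gibbs' (h x) * h1 x).
Proof.
move=> hC1 h0; have h10 x : 0 < 1 + h x by rewrite addr_gt0.
have s := C1D (C1_cst 1) hC1.
apply: (C1_eq (C1V (C1M hC1 (C1M s s)) _)) => x.
- by rewrite mulf_neq0 ?gt_eqF// mulr_gt0.
- by rewrite /gibbs expr2.
- by rewrite /gibbs'; field; rewrite !gt_eqF.
Qed.

Lemma potential_derive (y : R) : -1 < y ->
  is_derive y 1 (fun y => 1 / (2 + y) + ln ((1 + y) / (2 + y))) (gibbs (1 + y)).
Proof.
move=> y1; have p1 : 0 < 1 + y by lra. have p2 : 0 < 2 + y by lra.
have d1 (c : R) : is_derive y 1 (fun y => c + y) 1.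
  have := dvD (is_derive_cst c y 1) (is_derive_id y (1 : R)).
  by move/is_derive_eq; apply; rewrite add0r.
have d2 : is_derive y 1 (fun y => (2 + y)^-1) (- (2 + y) ^- 2).
  have := is_deriveV (lt0r_neq0 p2) (d1 2).
  by move/is_derive_eq; apply; rewrite /GRing.scale/= mulr1.
have d3 := dvM (d1 1) d2.
have pq : 0 < (1 + y) / (2 + y) by rewrite divr_gt0.
have d4 := dv_comp d3 (is_derive1_ln pq).
have d5 := dvM (is_derive_cst (1 : R) y 1) d2.
apply: is_derive_eq (dvD d5 d4) _.
by rewrite /gibbs /=; field; rewrite !gt_eqF//; lra.
Qed.

(** [profile_eq] is [F = 0] differentiated once, which removes the constant [M K(v)]. Multiplied by
    [h^3], it says that the flux vanishes identically. *)
Record profile (g M : R) (h h1 h2 h3 h4 : R -> R) : Prop := Profile {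
  profile01 : C1 h h1; profile12 : C1 h1 h2; profile23 : C1 h2 h3;
  profile34 : C1 h3 h4; profile_gt0 : forall x, 0 < h x;
  profile_eq : forall x, h3 x = g * h1 x - M * gibbs (h x) * h1 x }.

(** Bootstrap: the equation identifies [v''] almost everywhere with a continuous function [rhs] of
    [v], so [v] is C^2. Then [rhs] is C^1 with derivative [h3], and [h3] is a combination of
    products of C^1 functions. *)
Lemma profile_of_solution (k0 g M : R) (v : R -> R) :
  spaceU k0 v -> (\forall x \ae leb, F k0 g v M x = 0) ->
  exists h1 h2 h3 h4, profile g M (fun x => 1 + v x) h1 h2 h3 h4.
Proof.
move=> [[[_ cv [lv [wv [lv1 [wv1 [lv2 _]]]]]] _ _] v1] eqn.
pose pot x := potential v x.
pose rhs x := g * v x - M * pot x + M * K k0 v.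
have dpot x : is_derive (v x) 1 (fun y => 1 / (2 + y) + ln ((1 + y) / (2 + y)))
    (gibbs (1 + v x)) by exact: potential_derive.
have cpot : continuous pot.
  by move=> x; exact: (continuous_comp (cv x) (dv_cont (dpot x))).
have crhs : continuous rhs.
  move=> x.
  have c1 : {for x, continuous (fun x => g * v x)}.
    by apply: continuousM (cv x); exact: cst_continuous.
  have c2 : {for x, continuous (fun x => M * pot x)}.
    by apply: continuousM (cpot x); exact: cst_continuous.
  by apply: (continuousD (continuousB c1 c2) (@cst_continuous _ _ _ _)).
have wE : \forall x \ae leb, wderiv (wderiv v) x = rhs x.
  apply: ae_imp eqn => x; rewrite /F /rhs /pot => e; lra.
have [F1 [F1p F1e]] := weak_rep lv1 wv1.
have F1C : C1 F1 rhs := primitive_C1 lv2 F1p crhs wE.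
have [F0 [F0p F0e]] := weak_rep lv wv.
have F0C : C1 F0 F1 := primitive_C1 lv1 F0p (C1_cont F1C) F1e.
have vF0 : v = F0 by apply/funext; exact: (cont_ae_eq cv (C1_cont F0C) F0e).
have hC1 : C1 (fun x => 1 + v x) F1.
  by apply: (C1_eq (C1D (C1_cst 1) F0C)) => x; rewrite ?vF0 ?add0r.
have h0 x : 0 < 1 + v x by have := v1 x; lra.
have C1g := C1_gibbs hC1 h0.
have C1pot : C1 pot (fun x => gibbs (1 + v x) * F1 x).
  split=> x.
    have dv : is_derive x 1 v (F1 x) by rewrite vF0; exact: F0C.1.
    exact: (dv_comp dv (dpot x)).
  have c1 : {for x, continuous (fun x => gibbs (1 + v x))} by exact: (C1_cont C1g).
  have c2 : {for x, continuous F1} by exact: (C1_cont F1C).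
  exact: (continuousM c1 c2).
pose h3 x := g * F1 x - M * gibbs (1 + v x) * F1 x.
have C1rhs : C1 rhs h3.
  have vC1 : C1 v F1 by rewrite vF0.
  apply: (C1_eq (C1D (C1B (C1Z g vC1) (C1Z M C1pot)) (C1_cst (M * K k0 v)))) => x //.
  by rewrite /h3; ring.
have C1h3 := C1B (C1Z g F1C) (C1M (C1Z M C1g) F1C).
by exists F1, rhs, h3; eexists; split; [| | |exact: C1h3| |].
Qed.

Lemma profile_derivative g M h h1 h2 h3 h4 : profile g M h h1 h2 h3 h4 ->
  [/\ h^`()%classic = h1, h^`(3)%classic = h3 & h^`(4)%classic = h4].
Proof.
move=> p; have d (f f' : R -> R) : C1 f f' -> f^`()%classic = f'.
  by move=> [df _]; apply/funext => x; exact: dv_derive1.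
have e1 := d _ _ (profile01 p); have e2 := d _ _ (profile12 p).
have e3 := d _ _ (profile23 p); have e4 := d _ _ (profile34 p).
by split; rewrite ?derive1nS /= ?e1 ?e2 ?e3 ?e4.
Qed.

Lemma profile_stationary g M h h1 h2 h3 h4 : profile g M h h1 h2 h3 h4 ->
  stationary_solution g M h.
Proof.
move=> p; have [e1 e3 e4] := profile_derivative p.
have d (f f' : R -> R) : C1 f f' -> f^`()%classic = f'.
  by move=> [df _]; apply/funext => x; exact: dv_derive1.
have e2 := d _ _ (profile12 p).
split; first exact: profile_gt0 p.
- have der (f f' : R -> R) : C1 f f' -> forall x, derivable f x 1.
    by move=> [df _] x; case: (df x).
  case=> [|[|[|[|//]]]] _.
  + exact: der (profile01 p).
  + by rewrite (_ : h^`(1)%classic = h1)//; exact: der (profile12 p).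
  + rewrite (_ : h^`(2)%classic = h2); first exact: der (profile23 p).
    by rewrite derive1nS /= e1 e2.
  + by rewrite e3; exact: der (profile34 p).
- by rewrite e4; exact: (profile34 p).2.
- move=> x; rewrite (_ : flux g M h = cst 0); last first.
    apply/funext => y; rewrite /flux e3 e1 (profile_eq p) /gibbs/=.
    have hy := profile_gt0 p y; field.
    by rewrite !gt_eqF// addr_gt0.
  exact: dv_derive1 (is_derive_cst (0 : R) x 1).
Qed.

End regularity.

(** * Spectrum at the supremum of the energy quotient *)

(** Log-convexity makes the ratios [a (k+1) / a k] nondecreasing. A first ratio [rho > C] would
    force [a k >= rho^k a 0], beyond the bound [K C^k]. *)
Lemma log_convex_growth (R : realType) (a : nat -> R) (K C : R) :
  0 < C -> (forall k, 0 <= a k) -> (forall k, a k.+1 ^+ 2 <= a k * a k.+2) ->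
  (forall k, a k <= K * C ^+ k) -> a 1%N <= C * a 0%N.
Proof.
move=> C0 a0 conv aK; rewrite leNgt; apply/negP => Ca.
have [a00|a00] := eqVneq (a 0%N) 0.
  move: Ca; rewrite a00 mulr0 => a1.
  by have := conv 0%N; rewrite a00 mul0r leNgt exprn_gt0.
have {}a00 : 0 < a 0%N by rewrite lt_def a00 a0.
pose rho := a 1%N / a 0%N.
have Crho : C < rho by rewrite ltr_pdivlMr.
have rho0 : 0 < rho by exact: lt_trans C0 Crho.
have grow k : 0 < a k /\ rho * a k <= a k.+1.
  elim: k => [|k [ak IHk]]; first by rewrite /rho divfK ?gt_eqF.
  have ak1 : 0 < a k.+1 by rewrite (lt_le_trans _ IHk)// mulr_gt0.
  split => //; rewrite -(ler_pM2l ak); apply: le_trans (conv k).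
  rewrite expr2 mulrA.
  by rewrite  (mulrC (a k)) ler_wpM2r// ltW.
have ageo k : rho ^+ k * a 0%N <= a k.
  elim: k => [|k IHk]; first by rewrite mul1r.
  rewrite (le_trans _ (grow k).2)// exprS -mulrA ler_wpM2l// ltW//.
have aq k : a 0%N <= K * (C / rho) ^+ k.
  have := le_trans (ageo k) (aK k).
  rewrite [(C / rho) ^+ k]expr_div_n mulrA ler_pdivlMr ?exprn_gt0//.
  by rewrite mulrC.
have Klim : K * (C / rho) ^+ k @[k --> \oo] --> (0 : R).
  rewrite -[X in _ --> X](mulr0 K).
  apply: (cvgM (cvg_cst _)); apply: cvg_expr.
  rewrite ger0_norm; last by rewrite divr_ge0 ?(ltW C0) ?(ltW rho0).
  by rewrite ltr_pdivrMr// mul1r.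
suff : a 0%N <= 0 by rewrite leNgt a00.

by apply: (cvgr_to_ge Klim); exact: nearW.
Qed.

Lemma quadratic_ge0 (R : realFieldType) (a b c : R) : 0 <= c ->
  (forall l, 0 <= a + 2 * l * b + l ^+ 2 * c) -> b ^+ 2 <= a * c.
Proof.
move=> cge0 q; have [c0|c0] := eqVneq c 0.
  have [->|b0] := eqVneq b 0; first by rewrite c0 mulr0 expr0n.
  (* For [c = 0] the expression is affine in [l], and this [l] gives it the value -1. *)
  have := q (- (a + 1) / (2 * b)); rewrite c0 mulr0 addr0.
  have -> : a + 2 * (- (a + 1) / (2 * b)) * b = -1 by field.
  lra.
have {c0}cge0 : 0 < c by rewrite lt_def c0.
have := q (- b / c).
have -> : a + 2 * (- b / c) * b + (- b / c) ^+ 2 * c = (a * c - b ^+ 2) / c.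
  by field; rewrite gt_eqF.
by rewrite pmulr_lge0 ?invr_gt0// subr_ge0.
Qed.

(* If the supremum [mu] of the quotient [E p p / B p p] were in the resolvent set,
   with resolvent T bounded for the stronger form [Q], then T would be bounded
   for B as well (log-convexity of k |-> B (T^k q) (T^k q)), contradicting
   Cauchy-Schwarz for the nonnegative form [mu B - E] near the supremum. *)
Lemma no_resolvent_at_sup (R : realType) (D : Type) (B E : D -> D -> R)
    (Q : D -> R) (comb : D -> R -> D -> D) (K : R) :
  (forall p q, B p q = B q p) -> (forall p q, E p q = E q p) ->
  (forall p l q, B (comb p l q) (comb p l q)
                 = B p p + 2 * l * B p q + l ^+ 2 * B q q) ->
  (forall p l q, E (comb p l q) (comb p l q)
                 = E p p + 2 * l * E p q + l ^+ 2 * E q q) ->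
  (forall p, 0 <= B p p) -> (forall p, E p p <= K * B p p) ->
  (forall p, B p p <= Q p) -> (exists p, 0 < E p p) ->
  (forall mu, 0 < mu -> exists C, forall q, exists2 p,
     forall r, E p r = mu * B p r + B q r & Q p <= C * Q q) ->
  False.
Proof.
move=> Bsym Esym Bcomb Ecomb B0 EK BQ [p0 Ep0] resolvent.
have posB p : 0 < E p p -> 0 < B p p.
  move=> Ep; rewrite lt_def B0 andbT; apply/negP => /eqP Bp.
  by have := EK p; rewrite Bp mulr0 leNgt Ep.
pose S := [set r | exists2 p, 0 < B p p & r = E p p / B p p].
have Sp0 : S (E p0 p0 / B p0 p0) by exists p0 => //; exact: posB.
have supS : has_sup S.
  split; first by exists (E p0 p0 / B p0 p0).
  by exists K => _ [p Bp ->]; rewrite ler_pdivrMr.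
pose mu := sup S.
have mu0 : 0 < mu.
  apply: lt_le_trans (ub_le_sup supS.2 Sp0).
  by rewrite divr_gt0// posB.
have Emu p : E p p <= mu * B p p.
  have [Bp|Bp] := eqVneq (B p p) 0; first by rewrite (le_trans (EK p))// Bp !mulr0.
  have {}Bp : 0 < B p p by rewrite lt_def Bp B0.
  by rewrite -ler_pdivrMr//; apply: (ub_le_sup supS.2); exists p.
have [C /choice[T CT]] : exists C, forall q, exists p,
    (forall r, E p r = mu * B p r + B q r) /\ Q p <= C * Q q.
  have [C CT] := resolvent mu mu0; exists C => q.
  by have [p Ep Qp] := CT q; exists p.
have ET q := (CT q).1; have QT q := (CT q).2.
have Q0 p : 0 <= Q p := le_trans (B0 p) (BQ p).
pose C' := Num.max C 1.
have C'0 : 0 < C' by rewrite lt_max ltr01 orbT.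
have QT' q : Q (T q) <= C' * Q q.
  by rewrite (le_trans (QT q))// ler_wpM2r// le_max lexx.
(* Both sides equal [E (T x) (T y) - mu B (T x) (T y)]. *)
have Tsym x y : B x (T y) = B y (T x).
  have e1 := ET x (T y); have e2 := ET y (T x).
  by move: e1; rewrite Esym e2 (Bsym (T y)) => /addrI.
have BT q : B (T q) (T q) <= C' * B q q.
  apply: (@log_convex_growth _ (fun k => B (iter k T q) (iter k T q)) (Q q)) => //.
    move=> k; set x := iter k T q; rewrite -/(iter k.+2 T q) !iterS -/x.
    have -> : B (T x) (T x) = B x (T (T x)) by rewrite Tsym.
    apply: quadratic_ge0 => // l.
    by rewrite -Bcomb.
  move=> k; apply: le_trans (BQ _) _; elim: k => [|k IHk]; first by rewrite mulr1.
  by rewrite iterS (le_trans (QT' _))// exprS mulrCA ler_wpM2l// ltW.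
(* Cauchy-Schwarz for [A] at the pair [(T p, p)] will read [B p p ^ 2 <= (C' + 1) / 2 * e * B p p ^
   2]; this [e] makes the factor 1/2. *)
pose e := (C' + 1)^-1.
have e0 : 0 < e by rewrite invr_gt0 addr_gt0.
have [_ [p Bp ->] pmu] := sup_adherent e0 supS.
rewrite -/mu ltr_pdivlMr// in pmu.
pose A x y := mu * B x y - E x y.
have cs : A (T p) p ^+ 2 <= A (T p) (T p) * A p p.
  apply: quadratic_ge0 => [|l]; first by rewrite subr_ge0.
  have := Emu (comb (T p) l p); rewrite -subr_ge0 Bcomb Ecomb.
  by congr (0 <= _); rewrite /A; ring.
have e1 : A (T p) p = - B p p by rewrite /A ET; ring.
have e2 : A (T p) (T p) = - B p (T p) by rewrite /A ET; ring.
have e3 : A p p <= e * B p p by rewrite /A; lra.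
have e4 : - B p (T p) <= (B p p + B (T p) (T p)) / 2.
  have := B0 (comb p 1 (T p)); rewrite Bcomb; lra.
have e5 : - B p (T p) <= (C' + 1) / 2 * B p p.
  by have := BT p; lra.
move: cs; rewrite e1 e2 sqrrN leNgt => /negP; apply.
apply: (@le_lt_trans _ _ ((C' + 1) / 2 * B p p * (e * B p p))).
  apply: ler_pM => //; last by rewrite /A subr_ge0.
  by rewrite -e2 /A subr_ge0.
have -> : (C' + 1) / 2 * B p p * (e * B p p) = B p p ^+ 2 / 2.
  by rewrite /e; field; rewrite gt_eqF// addr_gt0.
by rewrite ltr_pdivrMr// ltr_pMr ?exprn_gt0//; lra.
Qed.

(** * The weighted mass and the energy form *)

Section energy.
Context {R : realType}.
Variables w V : R -> R.

(* With [p := d0], [d4] is [(p''' + V p')'], so that [N p = - d4 / w]. *)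
Record dom := Dom {
  d0 : R -> R; d1 : R -> R; d2 : R -> R; d3 : R -> R; d4 : R -> R;
  d01 : C1 d0 d1; d12 : C1 d1 d2; d23 : C1 d2 d3;
  d34 : C1 (fun x => d3 x + V x * d1 x) d4;
  d0_L2 : L2 setT d0; d1_L2 : L2 setT d1; d2_L2 : L2 setT d2;
  d3_L2 : L2 setT d3; d4_L2 : L2 setT d4 }.

Variables w0 w1 c : R.
Hypotheses (w_cont : continuous w) (V_cont : continuous V).
Hypotheses (w0_gt0 : 0 < w0) (w0_le : forall x, w0 <= w x)
  (w1_ge : forall x, w x <= w1).
Hypothesis V_le : forall x, `|V x| <= c.

Let c0 : 0 <= c. Proof. exact: le_trans (normr_ge0 _) (V_le 0). Qed.

Let w_ge0 x : 0 <= w x. Proof. exact: le_trans (ltW w0_gt0) (w0_le x). Qed.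

Let Lw f : L2 setT f -> L2 setT (fun x => w x * f x).
Proof.
apply: (@L2_bdd _ w1); first exact: cont_meas.
by move=> x; rewrite ger0_norm.
Qed.

Let LV f : L2 setT f -> L2 setT (fun x => V x * f x).
Proof. by apply: (@L2_bdd _ c) => //; exact: cont_meas. Qed.

Lemma comb_C1 (f f' g g' : R -> R) (l : R) : C1 f f' -> C1 g g' ->
  C1 (fun x => f x + l * g x) (fun x => f' x + l * g' x).
Proof. by move=> f1 g1; apply: C1D => //; exact: C1Z. Qed.

Lemma comb_L2 (f g : R -> R) (l : R) : L2 setT f -> L2 setT g ->
  L2 setT (fun x => f x + l * g x).
Proof. by move=> f1 g1; apply: L2D => //; exact: L2Z. Qed.

Lemma comb_C1_34 p l q : C1 (fun x => d3 p x + l * d3 q x + V x * (d1 p x + l * d1 q x))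
  (fun x => d4 p x + l * d4 q x).
Proof.
have := comb_C1 l (d34 p) (d34 q); congr C1.
by apply/funext => x; ring.
Qed.

Definition comb (p : dom) (l : R) (q : dom) : dom :=
  Dom (comb_C1 l (d01 p) (d01 q)) (comb_C1 l (d12 p) (d12 q))
    (comb_C1 l (d23 p) (d23 q)) (comb_C1_34 p l q)
    (comb_L2 l (d0_L2 p) (d0_L2 q)) (comb_L2 l (d1_L2 p) (d1_L2 q))
    (comb_L2 l (d2_L2 p) (d2_L2 q)) (comb_L2 l (d3_L2 p) (d3_L2 q))
    (comb_L2 l (d4_L2 p) (d4_L2 q)).

Definition mass (p q : dom) := \int[leb]_x (w x * d0 p x * d0 q x).
Definition energy (p q : dom) :=
  \int[leb]_x (V x * d1 p x * d1 q x - d2 p x * d2 q x).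

Lemma intg_mass p q : 'intg (fun x => w x * d0 p x * d0 q x).
Proof. by apply: L2_mul; [apply: Lw|]; exact: d0_L2. Qed.

Lemma intg_energy p q : 'intg (fun x => V x * d1 p x * d1 q x - d2 p x * d2 q x).
Proof.
apply: intgB; last by apply: L2_mul; exact: d2_L2.
by apply: L2_mul; [apply: LV|]; exact: d1_L2.
Qed.

Lemma massC p q : mass p q = mass q p.
Proof. by apply: eq_Rintegral => x _; ring. Qed.

Lemma energyC p q : energy p q = energy q p.
Proof. by apply: eq_Rintegral => x _; ring. Qed.

Lemma mass_comb p l q :
  mass (comb p l q) (comb p l q) = mass p p + 2 * l * mass p q + l ^+ 2 * mass q q.
Proof.
have i a b := intg_mass a b.
rewrite /mass -!IntZ // -!IntD; do ?[exact: i|apply: intgD|apply: intgZ] => //.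
by apply: eq_Rintegral => x _ /=; ring.
Qed.

Lemma energy_comb p l q : energy (comb p l q) (comb p l q)
  = energy p p + 2 * l * energy p q + l ^+ 2 * energy q q.
Proof.
have i a b := intg_energy a b.
rewrite /energy -!IntZ // -!IntD; do ?[exact: i|apply: intgD|apply: intgZ] => //.
by apply: eq_Rintegral => x _ /=; ring.
Qed.

Lemma mass_ge0 p : 0 <= mass p p.
Proof. by apply: Int_ge0 => x; rewrite -mulrA mulr_ge0// -expr2 sqr_ge0. Qed.

Lemma mass_ge p : w0 * \int[leb]_x (d0 p x ^+ 2) <= mass p p.
Proof.
rewrite -IntZ; last exact: L2_sq (d0_L2 p).
apply: Int_le; [by apply: intgZ; exact: L2_sq (d0_L2 p)|exact: intg_mass|].
by move=> x; rewrite -mulrA -expr2 ler_wpM2r// sqr_ge0.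
Qed.

(** Since [d4 p = - w N p], this says that the energy is the form of [N] in the inner product
    [mass]. *)
Lemma energy_ibp p q : energy p q = - \int[leb]_x (d4 p x * d0 q x).
Proof.
have G2 : L2 setT (fun x => d3 p x + V x * d1 p x).
  by apply: L2D; [exact: d3_L2|apply: LV; exact: d1_L2].
rewrite (L2_ibp (d34 p) (d01 q) G2 (d4_L2 p) (d0_L2 q) (d1_L2 q)) opprK.
under [RHS]eq_Rintegral do rewrite mulrDl.
rewrite IntD; last 2 first.
- by apply: L2_mul; [exact: d3_L2|exact: d1_L2].
- by apply: L2_mul; [apply: LV|]; exact: d1_L2.
rewrite (L2_ibp (d23 p) (d12 q) (d2_L2 p) (d3_L2 p) (d1_L2 q) (d2_L2 q)).
rewrite addrC /energy IntB//; first by apply: L2_mul; [apply: LV|]; exact: d1_L2.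
by apply: L2_mul; exact: d2_L2.
Qed.

Lemma energy_le1 p : energy p p <= c * \int[leb]_x (d1 p x ^+ 2).
Proof.
rewrite -IntZ; last exact: L2_sq (d1_L2 p).
apply: Int_le; [exact: intg_energy|by apply: intgZ; exact: L2_sq (d1_L2 p)|].
move=> x; rewrite -!mulrA -!expr2.
have Vc : V x <= c := le_trans (ler_norm _) (V_le x).
have := ler_wpM2r (sqr_ge0 (d1 p x)) Vc; have := sqr_ge0 (d2 p x); lra.
Qed.

(** Expand the integral of [(p'' + (c/2) p)^2], which is nonnegative, and use that the integral of
    [p'' p] is minus that of [p'^2]: this gives [c int p'^2 - int p''^2 <= (c^2/4) int p^2]. It
    makes the supremum of the quotient finite. *)
Lemma energy_le p : energy p p <= c ^+ 2 / (4 * w0) * mass p p.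
Proof.
have i0 := L2_sq (d0_L2 p); have i1 := L2_sq (d1_L2 p); have i2 := L2_sq (d2_L2 p).
have ibp := L2_ibp (d12 p) (d01 p) (d1_L2 p) (d2_L2 p) (d0_L2 p) (d1_L2 p).
have i20 := L2_mul (d2_L2 p) (d0_L2 p).
have le1 : energy p p <= \int[leb]_x (c * d1 p x ^+ 2 - d2 p x ^+ 2).
  apply: Int_le; [exact: intg_energy|by apply: intgB => //; exact: intgZ|].
  move=> x; rewrite -!mulrA -!expr2 lerD2r ler_wpM2r ?sqr_ge0//.
  exact: le_trans (ler_norm _) (V_le x).
have le2 : 0 <= \int[leb]_x (d2 p x + c / 2 * d0 p x) ^+ 2.
  by apply: Int_ge0 => x; exact: sqr_ge0.
have e2 : \int[leb]_x (d2 p x + c / 2 * d0 p x) ^+ 2 =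
    \int[leb]_x (d2 p x ^+ 2) + (c * \int[leb]_x (d2 p x * d0 p x)
      + c ^+ 2 / 4 * \int[leb]_x (d0 p x ^+ 2)).
  rewrite -!IntZ// -!IntD//; do ?[exact: i|apply: intgD|apply: intgZ] => //.
  by apply: eq_Rintegral => x _; field.
have le3 := mass_ge p.
rewrite IntB// ?IntZ// in le1; last exact: intgZ.
have e3 : \int[leb]_x (d1 p x ^+ 2) = \int[leb]_x (d1 p x * d1 p x).
  by apply: eq_Rintegral => x _; rewrite expr2.
have -> : c ^+ 2 / (4 * w0) * mass p p = c ^+ 2 / 4 * (mass p p / w0).
  by field; rewrite gt_eqF.
have le4 : \int[leb]_x (d0 p x ^+ 2) <= mass p p / w0.
  by rewrite ler_pdivlMr// mulrC.
have le5 : c ^+ 2 / 4 * \int[leb]_x (d0 p x ^+ 2) <= c ^+ 2 / 4 * (mass p p / w0).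
  by rewrite ler_wpM2l// divr_ge0// sqr_ge0.
rewrite e2 ibp -e3 in le2; lra.
Qed.

(** The equation [N p - mu p = q], multiplied by [w]. *)
Definition inverts (mu : R) (q p : dom) :=
  forall x, - d4 p x = w x * (mu * d0 p x + d0 q x).

Lemma inverts_energy mu q p r : inverts mu q p ->
  energy p r = mu * mass p r + mass q r.
Proof.
move=> eqn; rewrite energy_ibp /mass -IntZ; last exact: intg_mass.
rewrite -IntD; [|by apply: intgZ; exact: intg_mass|exact: intg_mass].
rewrite -mulN1r -IntZ; last by apply: L2_mul; [exact: d4_L2|exact: d0_L2].
by apply: eq_Rintegral => x _; rewrite mulN1r -mulNr eqn; ring.
Qed.

(** The hypothesis bounds only [int p'^2], while the abstract argument needs a norm that dominates
    the mass, hence [Q]. The mass of [p] is recovered from [E p p = mu B p p + B q p], where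
    [E p p <= c int p'^2] and the cross term is absorbed by Young's inequality with weight [mu]. *)
Lemma no_resolvent :
  (exists p, 0 < energy p p) ->
  (forall mu : R, 0 < mu -> exists C : R, forall q : dom, exists2 p : dom,
    inverts mu q p &
    \int[leb]_x (d1 p x ^+ 2) <= C * \int[leb]_x (d1 q x ^+ 2)) ->
  False.
Proof.
move=> pos solve.
pose Q p := mass p p + \int[leb]_x (d1 p x ^+ 2).
have I0 p : 0 <= \int[leb]_x (d1 p x ^+ 2) by apply: Int_ge0 => x; exact: sqr_ge0.
apply: (@no_resolvent_at_sup _ _ mass energy Q comb (c ^+ 2 / (4 * w0))) => //.
- exact: massC.
- exact: energyC.
- exact: mass_comb.
- exact: energy_comb.
- exact: mass_ge0.
- exact: energy_le.
- by move=> p; rewrite lerDl.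
move=> mu mu0; have [C solveC] := solve mu mu0.
clear pos solve.
exists (2 * c * `|C| / mu + 1 / mu ^+ 2 + `|C|) => q.
have [p eqn pC] := solveC q; exists p; first by move=> r; exact: inverts_energy.
have Ep := inverts_energy p eqn; clear solveC eqn.
have pC' : \int[leb]_x (d1 p x ^+ 2) <= `|C| * \int[leb]_x (d1 q x ^+ 2).
  by rewrite (le_trans pC)// ler_wpM2r// ler_norm.
have cs : - (2 * mass q p) <= mu * mass p p + mass q q / mu.
  have := mass_ge0 (comb q mu p); rewrite mass_comb.
  have -> : mass q q + 2 * mu * mass q p + mu ^+ 2 * mass p p
    = mu * (mu * mass p p + mass q q / mu + 2 * mass q p).
    by field; rewrite gt_eqF.
  by rewrite pmulr_rge0//; lra.
have le1 := energy_le1 p.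
have le2 := ler_wpM2l c0 pC'.
have le3 : mass p p <= (2 * (c * (`|C| * \int[leb]_x (d1 q x ^+ 2))) + mass q q / mu) / mu.
  by rewrite ler_pdivlMr// mulrC; lra.
have e3 : (2 * (c * (`|C| * \int[leb]_x (d1 q x ^+ 2))) + mass q q / mu) / mu
  = 2 * c * `|C| / mu * \int[leb]_x (d1 q x ^+ 2) + 1 / mu ^+ 2 * mass q q.
  by field; rewrite gt_eqF.
have h1 : 0 <= 2 * c * `|C| / mu by rewrite !mulr_ge0// invr_ge0 ltW.
have h2 : 0 <= 1 / mu ^+ 2 by rewrite divr_ge0// sqr_ge0.
rewrite e3 in le3.
have final (a b a' b' l m n : R) : 0 <= a -> 0 <= b -> 0 <= l -> 0 <= m -> 0 <= n ->
    a' <= l * b + m * a -> b' <= n * b -> a' + b' <= (l + m + n) * (a + b).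
  move=> a0 b0 l0 m0 n0 le4 le5; have := mulr_ge0 l0 a0; have := mulr_ge0 m0 b0.
  by have := mulr_ge0 n0 a0; lra.
by apply: final => //; exact: mass_ge0.
Qed.

End energy.

(** * A slowly varying bump has positive energy *)

Section bump.
Context {R : realType}.
Variable a : R.
Hypothesis a_gt0 : 0 < a.

(** The width is [1 / a]: as [a] tends to 0, the integral of [p'^2] scales like [a] and that of
    [p''^2] like [a^3], so the potential term wins. The power [n = 6] provides the four continuous
    derivatives that [dom] asks for. *)
Definition bump n (x : R) := pos (1 - (a * x) ^+ 2) ^+ n.

Lemma id_C1 : C1 (fun x : R => x) (fun=> 1).
Proof. by split => t; [exact: is_derive_id|exact: cst_continuous]. Qed.

Lemma bump_C1 n :
  C1 (bump n.+2) (fun x => n.+2%:R * bump n.+1 x * (- 2 * a ^+ 2 * x)).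
Proof.
have dy (x : R) : is_derive x 1 (fun x => 1 - (a * x) ^+ 2) (- 2 * a ^+ 2 * x).
  have := dvB (is_derive_cst (1 : R) x 1) (dvX 2 (dvZ a (is_derive_id x (1 : R)))).
  by move/is_derive_eq; apply; rewrite /= expr1; ring.
split=> x.
  exact: (dv_comp (dy x) ((pos_exp_C1 n).1 _)).
apply: (@continuousM _ _ (fun x => n.+2%:R * bump n.+1 x) (fun x => - 2 * a ^+ 2 * x)).
  have := (@pos_exp_C1 R n).2 (1 - (a * x) ^+ 2).
  exact: (continuous_comp (dv_cont (dy x))).
apply: continuousM; first exact: cst_continuous.
exact: cvg_id.
Qed.

Lemma bump_supported n : supported a^-1 (bump n.+1).
Proof.
move=> x ax; rewrite /bump pos_le ?expr0n//.
have : 1 < `|a * x|.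
  by rewrite normrM gtr0_norm// -ltr_pdivrMl// mulr1.
by rewrite -(real_normK (num_real (a * x))) => ?; nra.
Qed.

Lemma bump_bound n x : 0 <= bump n x <= 1.
Proof.
have p1 : pos (1 - (a * x) ^+ 2) <= 1.
  have [h|/ltW h] := leP 0 (1 - (a * x) ^+ 2).
    by rewrite pos_ge//; have := sqr_ge0 (a * x); lra.
  by rewrite pos_le.
by rewrite exprn_ge0 ?pos_ge0//= exprn_ile1// pos_ge0.
Qed.

Definition bump1 x := - 12 * a ^+ 2 * (x * bump 5 x).
Definition bump2 x :=
  - 12 * a ^+ 2 * bump 5 x + 120 * a ^+ 4 * (x * x * bump 4 x).

Lemma bump01 : C1 (bump 6) bump1.
Proof. by have := bump_C1 4; congr C1; apply/funext => x; rewrite /bump1; ring. Qed.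

Lemma bump12 : C1 bump1 bump2.
Proof.
have := C1Z (- 12 * a ^+ 2) (C1M id_C1 (bump_C1 3)).
by congr C1; apply/funext => x; rewrite /bump2; ring.
Qed.

Lemma bump23 : {bump3 & {bump4 | C1 bump2 bump3 /\ C1 bump3 bump4}}.
Proof.
pose b3 x := 360 * a ^+ 4 * (x * bump 4 x) + - 960 * a ^+ 6 * (x * x * x * bump 3 x).
have x2 := C1M id_C1 id_C1; have x3 := C1M x2 id_C1.
have d23 : C1 bump2 b3.
  have := C1D (C1Z (- 12 * a ^+ 2) (bump_C1 3)) (C1Z (120 * a ^+ 4) (C1M x2 (bump_C1 2))).
  by congr C1; apply/funext => x; rewrite /b3; ring.
exists b3; eexists; split; first exact: d23.
exact: C1D (C1Z (360 * a ^+ 4) (C1M id_C1 (bump_C1 2)))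
           (C1Z (- 960 * a ^+ 6) (C1M x3 (bump_C1 1))).
Qed.

Lemma bump1_supported : supported a^-1 bump1.
Proof. exact: supported_derive bump01 (@bump_supported 5). Qed.

Lemma bump2_supported : supported a^-1 bump2.
Proof. exact: supported_derive bump12 bump1_supported. Qed.

Lemma L2_cont_supported r (f : R -> R) : continuous f -> supported r f -> L2 setT f.
Proof.
move=> cf fr; apply/L2P; split; first exact: cont_meas.
apply: (@intg_cont_supported _ r); last by move=> x /fr ->; rewrite expr0n.
by move=> x; apply: (continuousM (cf x) (cf x)).
Qed.

Lemma intg_indic_itv (u v : R) : 'intg (\1_`[u, v] : R -> R).
Proof. exact: (integrable_indic_itv u v true false). Qed.

Lemma Int_indic_itv (u v : R) : u <= v ->
  \int[leb]_x (\1_`[u, v] x : R) = v - u.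
Proof.
move=> uv; rewrite /Rintegral integral_indic// setIT.
have e : lebesgue_measure (`[u, v]%classic : set R) = (v - u)%:E.
  by rewrite lebesgue_measure_itv/= lte_fin; case: ltgtP uv => //= -> _; rewrite subrr.
exact: (congr1 fine e).
Qed.

(** Where [1/4 <= a x <= 1/2], the factor [bump 5] is at least [(3/4)^5 >= 1/6], so
    [a x * bump 5 x >= 1/24], and [144 / 24^2 = 1/4]. *)
Lemma bump1_ge x : a ^+ 2 / 4 * \1_`[(4 * a)^-1, (2 * a)^-1] x <= bump1 x ^+ 2.
Proof.
rewrite indicE; case: (boolP (x \in _)) => [|_]; last by rewrite mulr0 sqr_ge0.
rewrite mulr1 inE/= in_itv/= => /andP[x1 x2].
have y1 : 1 / 4 <= a * x.
  by move: x1; rewrite -ler_pdivrMl// invfM; lra.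
have y2 : a * x <= 1 / 2.
  by move: x2; rewrite -ler_pdivlMl// invfM; lra.
have b3 : 3 / 4 <= 1 - (a * x) ^+ 2 by nra.
have b5 : (3 / 4) ^+ 5 <= bump 5 x.
  by rewrite /bump pos_ge ?lerXn2r// ?nnegrE; lra.
have b5' : 1 / 6 <= bump 5 x by apply: le_trans b5; lra.
have b6 : 1 / 24 <= (a * x) * bump 5 x.
  by rewrite (_ : 1 / 24 = 1 / 4 * (1 / 6)); [apply: ler_pM|]; lra.
have -> : bump1 x ^+ 2 = a ^+ 2 * (144 * ((a * x) * bump 5 x) ^+ 2).
  by rewrite /bump1; ring.
rewrite ler_wpM2l ?sqr_ge0//.
have : (1 / 24) ^+ 2 <= ((a * x) * bump 5 x) ^+ 2 by rewrite lerXn2r// ?nnegrE; lra.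
lra.
Qed.

(** On the support, 132 = 12 + 120 bounds the sum of the two coefficients of [bump2], since their
    cofactors lie in [0, 1]. *)
Lemma bump2_le x : bump2 x ^+ 2 <= 132 ^+ 2 * a ^+ 4 * \1_`[- a^-1, a^-1] x.
Proof.
have [xa|xa] := leP `|x| a^-1; last first.
  by rewrite (bump2_supported xa) expr0n/= !mulr_ge0// ?exprn_ge0 ?(ltW a_gt0)// indicE.
rewrite indicE mem_set/= ?mulr1; last by rewrite in_itv/= -ler_norml.
have y2 : (a * x) ^+ 2 <= 1.
  rewrite -(real_normK (num_real (a * x))) exprn_ile1// normrM gtr0_norm//.
  by rewrite -ler_pdivlMl// mulr1.
have y20 := sqr_ge0 (a * x).
have -> : bump2 x ^+ 2 = a ^+ 4 * (- 12 * bump 5 x + 120 * ((a * x) ^+ 2 * bump 4 x)) ^+ 2.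
  by rewrite /bump2; ring.
rewrite (mulrC (132 ^+ 2)) ler_wpM2l ?exprn_ge0 ?(ltW a_gt0)//.
have /andP[b5 b5'] := bump_bound 5 x; have /andP[b4 b4'] := bump_bound 4 x.
set u := bump 5 x in b5 b5' *.
have : 0 <= (a * x) ^+ 2 * bump 4 x <= 1 by rewrite mulr_ge0//= mulr_ile1.
move: (_ * bump 4 x) => z /andP[z0 z1].
rewrite -(real_normK (num_real (_ + _))) lerXn2r// ?nnegrE// ler_norml.
lra.
Qed.

End bump.

Lemma exists_positive_energy (R : realType) (V V' : R -> R) (kappa c : R) :
  C1 V V' -> 0 < kappa -> (forall x, kappa <= V x <= c) ->
  exists p : dom V, 0 < energy p p.
Proof.
move=> V1 k0 kV.
have [N N0 bump2N] : exists2 N : R, 0 < N & forall a x : R, 0 < a ->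
    bump2 a x ^+ 2 <= N * a ^+ 4 * \1_`[- a^-1, a^-1] x.
  by exists (132 ^+ 2); [exact/exprn_gt0/ltr0Sn|move=> a x a0; exact: bump2_le].
(* The energy will be at least [a (kappa / 16 - 2 N a^2)]. From [a <= 1] comes
   [a^2 <= a <= kappa / (33 N)], and 2/33 < 1/16. *)
pose a := Num.min 1 (kappa / (33 * N)).
have a0 : 0 < a by rewrite lt_min ltr01 divr_gt0// mulr_gt0.
have [b3 [b4 [b23 b34]]] := bump23 a.
have s2 := bump2_supported a0; have s1 := bump1_supported a0.
have s3 := supported_derive b23 s2; have s4 := supported_derive b34 s3.
have b12 := bump12 a; have b01 := bump01 a.
have sG : supported a^-1 (fun x => b3 x + V x * bump1 a x).
  by move=> x xa; rewrite s3// s1// mulr0 addr0.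
have G1 := C1D b34 (C1M V1 b12).
have Vcont : continuous V := C1_cont V1.
have lift f f' : C1 f f' -> supported a^-1 f -> L2 setT f.
  by move=> f1; apply: L2_cont_supported; exact: C1_cont f1.
have L0 := lift _ _ b01 (@bump_supported _ _ a0 5).
have L1 := lift _ _ b12 s1; have Ld2 := lift _ _ b23 s2; have L3 := lift _ _ b34 s3.
have L4 := L2_cont_supported G1.2 (supported_derive G1 sG).
exists (Dom b01 b12 b23 G1 L0 L1 Ld2 L3 L4); rewrite /energy /=.
have i2 := L2_sq Ld2; have i1 := L2_sq L1.
have Vb1 : L2 setT (fun x => V x * bump1 a x).
  have cb1 : continuous (bump1 a) := C1_cont b12.
  apply: (@L2_cont_supported _ a^-1); last by move=> x /s1 ->; rewrite mulr0.
  by move=> x; apply: (@continuousM _ _ V (bump1 a) x (Vcont x) (cb1 x)).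
have lower : \int[leb]_x (kappa * (a ^+ 2 / 4 * \1_`[(4 * a)^-1, (2 * a)^-1] x)
     - N * a ^+ 4 * \1_`[- a^-1, a^-1] x)
   <= \int[leb]_x (V x * bump1 a x * bump1 a x - bump2 a x * bump2 a x).
  apply: Int_le.
  - apply: intgB; first by do 2 apply: intgZ; exact: intg_indic_itv.
    by apply: intgZ; exact: intg_indic_itv.
  - by apply: intgB; exact: L2_mul.
  - move=> x; rewrite -[V x * _ * _]mulrA -!expr2 lerB ?bump2N//.
    apply: (@le_trans _ _ (kappa * bump1 a x ^+ 2)).
      by rewrite (ler_wpM2l (ltW k0))// bump1_ge.
    by rewrite ler_wpM2r ?sqr_ge0//; case/andP: (kV x).
apply: lt_le_trans lower.
rewrite IntB; last 2 first.
- by do 2 apply: intgZ; exact: intg_indic_itv.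
- by apply: intgZ; exact: intg_indic_itv.
rewrite !IntZ; do ?[exact: intg_indic_itv|apply: intgZ].
have ai : 0 < a^-1 by rewrite invr_gt0.
rewrite !Int_indic_itv; [|lra|by rewrite !invfM; lra].
have -> : kappa * (a ^+ 2 / 4 * ((2 * a)^-1 - (4 * a)^-1)) -
    N * a ^+ 4 * (a^-1 - - a^-1) = a * (kappa / 16 - 2 * N * a ^+ 2).
  by field; rewrite gt_eqF.
rewrite mulr_gt0// subr_gt0.
have a1 : a <= 1 by rewrite ge_min lexx.
have a2 : a * (33 * N) <= kappa by rewrite -ler_pdivlMr ?mulr_gt0// ge_min lexx orbT.
have a3 : a ^+ 2 <= a by rewrite expr2 ler_piMl// ltW.
have a4 := mulr_gt0 a0 N0.
have := ler_wpM2r (ltW N0) a3; lra.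
Qed.

(** * From the resolvent of the linearisation to the symmetric operator *)

Section resolvent.
Context {R : realType}.

Lemma cL2_norm_sq (u : R -> R[i]) : (cL2_norm u `^ 2 =
  \int[leb]_x ((complex.Re (u x)) ^+ 2 + (complex.Im (u x)) ^+ 2)%:E)%E.
Proof.
rewrite /cL2_norm poweR_Lnorm//; apply: eq_integral => x _.
rewrite /= ger0_norm; last by case: (u x) => a b /=; exact: sqrtr_ge0.
rewrite -[2]/(2%:R) powR_mulrn; last by case: (u x) => a b /=; exact: sqrtr_ge0.
by case: (u x) => a b /=; rewrite sqr_sqrtr// addr_ge0// sqr_ge0.
Qed.

Lemma Int_EFin (f : R -> R) : 'intg f ->
  (\int[leb]_x (f x)%:E = (\int[leb]_x f x)%:E)%E.
Proof. by move=> i; rewrite /Rintegral fineK//; exact: integrable_fin_num. Qed.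

Lemma cL2_norm_Re (u : R -> R[i]) (q : R -> R) (C : R) : cL2 u -> L2 setT q ->
  (cL2_norm u <= C%:E * cL2_norm (fun x => (q x)%:C%C))%E ->
  \int[leb]_x (complex.Re (u x) ^+ 2) <= C ^+ 2 * \int[leb]_x (q x ^+ 2).
Proof.
move=> [re im] q2 uq; have ire := L2_sq re; have iim := L2_sq im; have iq := L2_sq q2.
have N0 v : (0 <= cL2_norm v)%E by exact: Lnorm_ge0.
(* The constant of the resolvent bound may be negative, whereas squaring needs a nonnegative
   right-hand side. *)
have {}uq : (cL2_norm u <= `|C|%:E * cL2_norm (fun x => (q x)%:C%C))%E.
  by apply: (le_trans uq); apply: lee_wpmul2r; [exact: N0|rewrite lee_fin ler_norm].
have : (cL2_norm u `^ 2 <= (`|C|%:E * cL2_norm (fun x => (q x)%:C%C)) `^ 2)%E.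
  apply: gt0_ler_poweR => //; rewrite in_itv/= leey andbT.
    exact: N0.
  by apply: mule_ge0; [rewrite lee_fin|exact: N0].
rewrite poweRM ?lee_fin ?N0// !cL2_norm_sq poweR_EFin -[2]/(2%:R) powR_mulrn//.
rewrite real_normK ?num_real// /=.
rewrite (Int_EFin (intgD ire iim)).
have -> : (fun x => (q x ^+ 2 + 0 ^+ 2)%:E) = (fun x => (q x ^+ 2)%:E).
  by apply/funext => x; rewrite expr0n/= addr0.
rewrite (Int_EFin iq) -EFinM lee_fin; apply: le_trans.
apply: Int_le => //; first exact: intgD.
by move=> x; rewrite lerDl sqr_ge0.
Qed.

Lemma weakly_C1 (f F1 : R -> R) : L2loc f -> weakly_derivable f ->
  (\forall x \ae leb, wderiv f x = F1 x) -> continuous F1 ->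
  exists2 F0, C1 F0 F1 & \forall x \ae leb, f x = F0 x.
Proof.
move=> lf wf f1 cF1; have [F0 [F0p F0e]] := weak_rep lf wf.
by exists F0 => //; apply: primitive_C1 F0p cF1 f1; have [] := wderivP wf.
Qed.

(** Lower case: the function and its weak derivatives of orders 1 and 3, the ones that the flux
    contains. Upper case: the continuous representatives of orders 0 to 3, each the classical
    derivative of the one before. *)
Record H4_rep (a a1 a3 A0 A1 A2 A3 : R -> R) : Prop := H4Rep {
  rep01 : C1 A0 A1; rep12 : C1 A1 A2; rep23 : C1 A2 A3;
  rep0_L2 : L2 setT A0; rep1_L2 : L2 setT A1; rep2_L2 : L2 setT A2;
  rep3_L2 : L2 setT A3;
  rep0 : \forall x \ae leb, a x = A0 x;
  rep1 : \forall x \ae leb, a1 x = A1 x;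
  rep3 : \forall x \ae leb, a3 x = A3 x;
  rep_L2 : [/\ L2 setT a, L2 setT a1 & L2 setT a3];
  rep_wd : [/\ weakly_derivable a, weakly_derivable a1 & weakly_derivable a3] }.

Lemma exists_H4_rep (a : R -> R) : sobolev (L2 setT) 4 a ->
  exists A0 A1 A2 A3, H4_rep a (wderiv a) (wderiv (wderiv (wderiv a))) A0 A1 A2 A3.
Proof.
move=> [a_L2 [wa [a1_L2 [wa1 [a2_L2 [wa2 [a3_L2 [wa3 [a4_L2 _]]]]]]]]].
have [A3 [A3p A3e]] := weak_rep (L2_L2loc a3_L2) wa3.
have cA3 := primitive_cont (L2_L2loc a4_L2) A3p.
have [A2 A2C A2e] := weakly_C1 (L2_L2loc a2_L2) wa2 A3e cA3.
have [A1 A1C A1e] := weakly_C1 (L2_L2loc a1_L2) wa1 A2e (C1_cont A2C).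
have [A0 A0C A0e] := weakly_C1 (L2_L2loc a_L2) wa A1e (C1_cont A1C).
exists A0, A1, A2, A3; split=> //.
- exact: (L2_ae (cont_meas (C1_cont A0C)) A0e a_L2).
- exact: (L2_ae (cont_meas (C1_cont A1C)) A1e a1_L2).
- exact: (L2_ae (cont_meas (C1_cont A2C)) A2e a2_L2).
- exact: (L2_ae (cont_meas cA3) A3e a3_L2).
Qed.

Variables (g M : R) (h h1 h2 h3 h4 : R -> R).
Hypothesis pr : profile g M h h1 h2 h3 h4.

Definition pot_fun (x : R) := M * gibbs (h x) - g.
Definition pot_fun' (x : R) := M * (gibbs' (h x) * h1 x).
Definition weight (x : R) := (h x ^+ 3)^-1.

Variables K1 K2 K3 : R.
Hypotheses (hK : forall x, `|h x ^+ 3| <= K1) (VK : forall x, `|pot_fun x| <= K2)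
  (VK' : forall x, `|pot_fun' x| <= K3).

Let h_gt0 := profile_gt0 pr.
Let hC1 := profile01 pr.

Lemma pot_fun_C1 : C1 pot_fun pot_fun'.
Proof.
apply: (C1_eq (C1B (C1Z M (C1_gibbs hC1 h_gt0)) (C1_cst g))) => x //.
by rewrite subr0.
Qed.

(** [h^3] times the derivative of [a'' + V a], expanded so that it applies to weak derivatives. *)
Definition real_flux (a a1 a3 : R -> R) (x : R) :=
  h x ^+ 3 * (a3 x + (pot_fun x * a1 x + pot_fun' x * a x)).

(** The flux contains [V' a]; the product rule that makes it weakly derivable asks [V'] to be
    C^1. *)
Lemma pot_fun'_C1 : exists k, C1 pot_fun' k.
Proof.
have h10 x : 0 < 1 + h x by rewrite addr_gt0.
have s := C1D (C1_cst 1) hC1.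
have dC1 := C1M (C1M hC1 hC1) (C1M s (C1M s s)).
have d0 x : h x * h x * ((1 + h x) * ((1 + h x) * (1 + h x))) != 0.
  by rewrite gt_eqF// !mulr_gt0.
have := C1Z M (C1M (C1M (C1Z (-1) (C1D (C1_cst 1) (C1Z 3 hC1))) (C1V dC1 d0))
  (profile12 pr)).
set k := (X in C1 _ X) => kC1; exists k; apply: (C1_eq kC1) => x //.
by rewrite /pot_fun' /gibbs'; field; rewrite !gt_eqF.
Qed.

(** The coefficients are real, so real parts decouple. Substituting [profile_eq] for [h'''] turns
    the zero-order coefficient into [h^3 V']. *)
Lemma Re_linearised_flux (u : R -> R[i]) :
  (fun x => complex.Re (linearised_flux g M h u x)) =
  real_flux (fun x => complex.Re (u x)) (wderiv (fun x => complex.Re (u x)))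
    (wderiv (wderiv (wderiv (fun x => complex.Re (u x))))).
Proof.
have [e1 e3 e4] := profile_derivative pr.
apply/funext => x; rewrite /linearised_flux e1 e3 (profile_eq pr) /=.
have reM (c : R) z : complex.Re (c%:C%C * z) = c * complex.Re z.
  by case: z => b d; rewrite /= mul0r subr0.
have reD z1 z2 : complex.Re (z1 + z2) = complex.Re z1 + complex.Re z2 :> R.
  by case: z1; case: z2.
have reB z1 z2 : complex.Re (z1 - z2) = complex.Re z1 - complex.Re z2 :> R.
  by case: z1; case: z2.
rewrite !(reD, reM, reB) /= /real_flux /pot_fun /pot_fun' /gibbs /gibbs'.
have h0 := h_gt0 x.
by field; rewrite !gt_eqF// addr_gt0.
Qed.

(** The equation makes the weak derivative of the flux continuous, so the flux has a C^1
    representative [Phi] with [Phi' = - mu A0 - q']. Hence [p = - (Phi + q) / mu] satisfies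
    [p' = A0] and lies in L^2, and [Phi = h^3 G'] turns its definition into the equation required by
    [inverts]. *)
Lemma inverts_of_rep (mu : R) (q : dom pot_fun) (a a1 a3 A0 A1 A2 A3 : R -> R) :
  0 < mu -> H4_rep a a1 a3 A0 A1 A2 A3 ->
  (\forall x \ae leb, - wderiv (real_flux a a1 a3) x - mu * a x = d1 q x) ->
  exists2 p : dom pot_fun, inverts weight mu q p & d1 p = A0.
Proof.
move=> mu0 [A0C A1C A2C A0_L2 A1_L2 A2_L2 A3_L2 A0e A1e A3e
  [a_L2 a1_L2 a3_L2] [wa wa1 wa3]] eqRe.
have [l0 l1 l3] := And3 (L2_L2loc a_L2) (L2_L2loc a1_L2) (L2_L2loc a3_L2).
have cA0 := C1_cont A0C.
have VC1 := pot_fun_C1; have cV := C1_cont VC1; have cV' := VC1.2.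
have h3C1 : C1 (fun x => h x ^+ 3)
    (fun x => (h1 x * h x + h x * h1 x) * h x + h x * h x * h1 x).
  by apply: (C1_eq (C1M (C1M hC1 hC1) hC1)) => x //; rewrite !exprS expr0; ring.
have ch3 := C1_cont h3C1.
have VA_L2 (B1 B0 B3 : R -> R) : L2 setT B1 -> L2 setT B0 -> L2 setT B3 ->
    L2 setT (fun x => B3 x + (pot_fun x * B1 x + pot_fun' x * B0 x)).
  move=> b1 b0 b3; apply: L2D => //; apply: L2D.
    exact: (L2_bdd (cont_meas cV) VK b1).
  exact: (L2_bdd (cont_meas cV') VK' b0).
pose fl := real_flux a a1 a3.
have fl_L2 : L2 setT fl.
  exact: (L2_bdd (cont_meas ch3) hK (VA_L2 _ _ _ a1_L2 a_L2 a3_L2)).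
have [V'' V'C1] := pot_fun'_C1.
have wfl : weakly_derivable fl.
  have t1 := weakly_derivable_mulc VC1 l1 wa1.
  have t0 := weakly_derivable_mulc V'C1 l0 wa.
  have m1 := L2loc_mulc cV l1; have m0 := L2loc_mulc cV' l0.
  have t := weakly_derivableD l3 (L2locD m1 m0) wa3 (weakly_derivableD m1 m0 t1 t0).
  exact: (weakly_derivable_mulc h3C1 (L2locD l3 (L2locD m1 m0)) t).
have [Phi [Phip Phie]] := weak_rep (L2_L2loc fl_L2) wfl.
have [lwfl _] := wderivP wfl.
pose rhs x := - (mu * A0 x) - d1 q x.
have cq1 : continuous (d1 q) := C1_cont (d12 q).
have crhs : continuous rhs.
  move=> x; apply: continuousB (cq1 x); apply: continuousN.
  by apply: continuousM (cA0 x); exact: cst_continuous.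
have wfle : \forall x \ae leb, wderiv fl x = rhs x.
  by apply: ae_imp2 eqRe A0e => x e1 e2; rewrite /rhs -e2 -e1; ring.
have PhiC1 : C1 Phi rhs := primitive_C1 lwfl Phip crhs wfle.
pose G' x := A3 x + (pot_fun' x * A0 x + pot_fun x * A1 x).
have GC1 : C1 (fun x => A2 x + pot_fun x * A0 x) G' := C1D A2C (C1M VC1 A0C).
have PhiE : forall x, Phi x = h x ^+ 3 * G' x.
  apply: cont_ae_eq.
  - exact: C1_cont PhiC1.
  - by move=> x; exact: (continuousM (ch3 x) (GC1.2 x)).
  - have e3 := ae_imp2 (fun x e1 e2 => conj e1 e2) A3e A1e.
    have e4 := ae_imp2 (fun x e1 e2 => conj e1 e2) A0e Phie.
    apply: ae_imp2 e3 e4 => x [e3 e1] [e0 e5].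
    by rewrite -e5 /fl /real_flux -/a e0 e1 e3 /G'; ring.
pose p x := - mu^-1 * (Phi x + d0 q x).
have pC1 : C1 p A0.
  apply: (C1_eq (C1Z (- mu^-1) (C1D PhiC1 (d01 q)))) => x //.
  by rewrite /rhs; field; rewrite gt_eqF.
have G'_L2 : L2 setT G'.
  have := VA_L2 _ _ _ A1_L2 A0_L2 A3_L2; congr (L2 _ _).
  by apply/funext => x; rewrite /G' [X in _ + X]addrC.
have Phi_L2 : L2 setT Phi.
  have := L2_bdd (cont_meas ch3) hK G'_L2; congr (L2 _ _).
  by apply/funext => x; rewrite PhiE.
have p_L2 : L2 setT p by apply: L2Z; apply: L2D => //; exact: d0_L2.
exists (Dom pC1 A0C A1C GC1 p_L2 A0_L2 A1_L2 A2_L2 G'_L2); last exact: erefl.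
move=> x /=; rewrite /weight /p PhiE; have h0 := h_gt0 x.
by field; rewrite !gt_eqF.
Qed.

(** The resolvent is applied to the real datum [q'], and the real part of the solution is kept. The
    constant is squared because the bound is on squared norms. *)
Lemma resolvent_inverts (mu : R) : 0 < mu ->
  in_resolvent_set (cH 4) (linearisation g M h) (mu%:C)%C ->
  exists C : R, forall q : dom pot_fun, exists2 p : dom pot_fun,
    inverts weight mu q p &
    \int[leb]_x (d1 p x ^+ 2) <= C * \int[leb]_x (d1 q x ^+ 2).
Proof.
move=> mu0 [_ [C solve]]; exists (C ^+ 2) => q.
have fL2 : cL2 (fun x => (d1 q x)%:C%C).
  split; first exact: d1_L2.
  apply/L2P; split; first exact: measurable_cst.
  rewrite (_ : (fun _ => _) = cst 0); first exact: integrable0.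
  by apply/funext => x /=; rewrite expr0n.
have [u [[sre sim] eqn un]] := solve _ fL2; clear solve.
have [A0 [A1 [A2 [A3 rep]]]] := exists_H4_rep sre.
have u_L2 : cL2 u by split; [case: (rep_L2 rep)|case: sim].
have eqRe : \forall x \ae leb, - wderiv (real_flux (fun x => complex.Re (u x))
    (wderiv (fun x => complex.Re (u x)))
    (wderiv (wderiv (wderiv (fun x => complex.Re (u x)))))) x - mu * complex.Re (u x)
    = d1 q x.
  apply: ae_imp eqn => x; rewrite /linearisation => /(congr1 (@complex.Re R)).
  rewrite -Re_linearised_flux [RHS]/= => <-.
  rewrite [in LHS](_ : wderiv _ x = complex.Re (cwderiv (linearised_flux g M h u) x))//.
  case: (cwderiv _ x) => b1 b2; case: (u x) => b3 b4 /=.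
  by rewrite mul0r subr0.
have [p pq pA0] := inverts_of_rep mu0 rep eqRe; exists p => //.
rewrite pA0 (_ : \int[leb]_x (A0 x ^+ 2) = \int[leb]_x (complex.Re (u x) ^+ 2)).
  by apply: cL2_norm_Re un => //; exact: d1_L2.
apply: Rintegral_ae_eq => //.
- by apply: measurable_funX; exact: L2_meas (rep0_L2 rep).
- by apply: measurable_funX; exact: L2_meas u_L2.1.
- by apply: ae_imp (rep0 rep) => x ->.
Qed.

End resolvent.

(** * Smallness in [H2per] controls the supremum *)

Section periodic.
Context {R : realType}.

Lemma periodic_int (T : R) (f : R -> R) : (forall x, f (x + T) = f x) ->
  forall (n : int) x, f (x + n%:~R * T) = f x.
Proof.
move=> fT; have nat n x : f (x + n%:R * T) = f x.
  elim: n => [|n IHn]; first by rewrite mul0r addr0.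
  by rewrite -natr1 mulrDl mul1r addrA fT.
move=> [n|n] x; first exact: nat.
by rewrite NegzE mulrNz mulNr -[in RHS](subrK (n.+1%:R * T) x) nat.
Qed.

Lemma periodic_reduce (T : R) (f : R -> R) : 0 < T -> (forall x, f (x + T) = f x) ->
  forall x, exists2 y, - (T / 2) <= y <= T / 2 & f y = f x.
Proof.
move=> T0 fT x; pose n := Num.floor (x / T + 1 / 2).
have n1 : n%:~R <= x / T + 1 / 2 by exact: Num.Theory.floor_le.
have n2 : x / T + 1 / 2 < n%:~R + 1.
  by have := Num.Theory.floorD1_gt (x / T + 1 / 2); rewrite intrD.
exists (x + (- n)%:~R * T); last exact: periodic_int.
have -> : x + (- n)%:~R * T = (x / T - n%:~R) * T.
  by rewrite mulrNz mulrBl divfK ?gt_eqF// mulNr.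
have -> : - (T / 2) = (- (1 / 2)) * T by ring.
have -> : T / 2 = (1 / 2) * T by ring.
by rewrite !ler_pM2r//; apply/andP; split; lra.
Qed.

Lemma periodic_bounded (T : R) (f : R -> R) : 0 < T -> (forall x, f (x + T) = f x) ->
  continuous f -> exists K, forall x, `|f x| <= K.
Proof.
move=> T0 fT cf; have [K fK] := cont_bounded_itv (- (T / 2)) (T / 2) cf.
by exists K => x; have [y yT <-] := periodic_reduce T0 fT x; exact: fK.
Qed.

Lemma periodic_derive (T : R) (f f' : R -> R) : C1 f f' -> (forall x, f (x + T) = f x) ->
  forall x, f' (x + T) = f' x.
Proof.
move=> f1 fT x; have := C1_affine_comp 1 T f1 => -[/(_ x) d _].
rewrite (_ : (fun x => f (1 * x + T)) = f) in d; last by apply/funext => y; rewrite mul1r.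
by have := dv_derive1 d; rewrite (dv_derive1 (f1.1 x)) !mul1r.
Qed.

Lemma Rintegral_oo_cc (f : R -> R) (a b : R) : leb.-integrable `[a, b] (EFin \o f) ->
  \int[leb]_(x in `]a, b[) f x = \int[leb]_(x in `[a, b]) f x.
Proof.
move=> i; rewrite Rintegral_itv_bndo_bndc ?Rintegral_itv_obnd_cbnd//.
- by apply: integrableS i; do ?exact: measurable_itv; exact: subset_itv_oc_cc.
- by apply: integrableS i; do ?exact: measurable_itv; exact: subset_itv_oo_cc.
Qed.

Lemma H2per_norm_le (k0 d : R) (v : R -> R) : 0 <= d -> H2per_norm k0 v <= d ->
  \int[leb]_(x in cell k0) (v x ^+ 2) <= d ^+ 2 /\
  \int[leb]_(x in cell k0) (wderiv v x ^+ 2) <= d ^+ 2.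
Proof.
move=> d0; have I0 (f : R -> R) : 0 <= \int[leb]_(x in cell k0) (f x ^+ 2).
  by apply: Rintegral_ge0 => x _; exact: sqr_ge0.
rewrite /H2per_norm => vd.
have term (j : 'I_3) : \int[leb]_(x in cell k0) (iter j (@wderiv R) v x ^+ 2) <= d ^+ 2.
  apply: (@le_trans _ _ (\sum_(i < 3) \int[leb]_(x in cell k0) (iter i (@wderiv R) v x) ^+ 2)).
    by rewrite (bigD1 j)// lerDl sumr_ge0.
  move: vd; set S := bigop _ _ _ => vd.
  have S0 : 0 <= S by rewrite sumr_ge0.
  by rewrite -(sqr_sqrtr S0) lerXn2r// nnegrE sqrtr_ge0.
split; first exact: (term ord0).
exact: (term (Ordinal (isT : 1 < 3)%N)).
Qed.

(** A Sobolev embedding by hand: a small integral of [v^2] gives a point of the period cell where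
    [|v| <= e/2], and a small integral of [v'^2] keeps the oscillation over the cell below [e/2]. *)
Lemma H2per_sup (k0 e : R) : 0 < k0 -> 0 < e -> exists2 d : R, 0 < d &
  forall v, H2per k0 v -> H2per_norm k0 v <= d -> forall x, `|v x| <= e.
Proof.
move=> k0_gt0 e0; pose L := pi / k0.
have L0 : 0 < L by rewrite divr_gt0// pi_gt0.
have L1 : 0 < 2 * L + 1 by lra.
(* Chosen for two inequalities. [d (2 L + 1) <= e / 2] bounds the oscillation when [primitive_osc]
   is used with [d] itself as parameter; [d^2 < (e/2)^2 * 2 L] excludes [|v| >= e/2] on the whole
   cell. *)
pose d := e / 2 * (2 * L / (2 * L + 1) ^+ 2).
have d0 : 0 < d.
  by apply: mulr_gt0; apply: divr_gt0 => //; [exact: mulr_gt0|exact: exprn_gt0].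
have dL : d * (2 * L + 1) <= e / 2.
  have -> : d * (2 * L + 1) = e / 2 * (2 * L / (2 * L + 1)).
    by rewrite /d; field; rewrite gt_eqF.
  have q1 : 2 * L / (2 * L + 1) <= 1 by rewrite ler_pdivrMr//; lra.
  by rewrite ler_piMr// ltW// divr_gt0.
have dsq : d ^+ 2 < (e / 2) ^+ 2 * (2 * L).
  rewrite /d exprMn ltr_pM2l ?exprn_gt0 ?divr_gt0//.
  rewrite expr_div_n ltr_pdivrMr ?exprn_gt0//.
  have L2 := mulr_gt0 L0 L0; have L3 := mulr_gt0 L0 L2; have L4 := mulr_gt0 L0 L3.
  have L5 := mulr_gt0 L0 L4.
  rewrite -subr_gt0 [X in 0 < X](_ : _ = 32 * (L * (L * (L * (L * L)))) +
    64 * (L * (L * (L * L))) + 48 * (L * (L * L)) + 12 * (L * L) + 2 * L); first lra.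
  by ring.
exists d => // v [vT cv [lv [wv [lv1 _]]]] /(H2per_norm_le (ltW d0))[I0 I1].
have cell_itv f : L2loc f ->
    \int[leb]_(x in cell k0) (f x ^+ 2) = \int[leb]_(x in `[- L, L]) (f x ^+ 2).
  by move=> lf; rewrite /cell Rintegral_oo_cc//; exact: L2loc_sq.
rewrite cell_itv// in I0; rewrite cell_itv// in I1.
have [G [Gp Ge]] := weak_rep lv wv.
have vG := cont_ae_eq cv (primitive_cont lv1 Gp) Ge.
have osc a b : - L <= a -> a <= b -> b <= L -> `|v b - v a| <= e / 2.
  move=> La ab bL; rewrite !vG; apply: (le_trans (primitive_osc lv1 Gp ab d0)).
  have h1 : \int[leb]_(t in `[a, b]) (wderiv v t ^+ 2) <= d ^+ 2.
    apply: le_trans I1; apply: Rint_subset.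
    - exact: measurable_itv.
    - exact: measurable_itv.
    - by apply: subset_itv; rewrite bnd_simp.
    - by move=> t; exact: sqr_ge0.
    - exact: L2loc_sq.
  have h2 : \int[leb]_(t in `[a, b]) (wderiv v t ^+ 2) / d <= d.
    by rewrite ler_pdivrMr// -expr2.
  have h3 : d * (b - a) <= d * (2 * L) by apply: ler_wpM2l; [exact: ltW|lra].
  lra.
have [y /andP[y1 y2] vy] : exists2 y, - L <= y <= L & `|v y| <= e / 2.
  apply: contrapT => no.
  have big y : - L <= y <= L -> e / 2 <= `|v y|.
    by move=> yL; rewrite leNgt; apply/negP => vy; apply: no; exists y => //; exact: ltW.
  have : (e / 2) ^+ 2 * (2 * L) <= \int[leb]_(x in `[- L, L]) (v x ^+ 2).
    have <- : \int[leb]_(x in `[- L, L]) cst ((e / 2) ^+ 2) x = (e / 2) ^+ 2 * (2 * L).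
      rewrite Rintegral_cst//; congr (_ * _).
      have ee : lebesgue_measure (`[- L, L]%classic : set R) = (2 * L)%:E.
        rewrite lebesgue_measure_itv/= lte_fin ifT ?gtrN//.
        by rewrite -EFinB; congr (_%:E); ring.
      exact: (congr1 fine ee).
    apply: le_Rintegral; [exact: measurable_itv|exact: intg_cst_itv|exact: L2loc_sq|].
    move=> x; rewrite /= in_itv/= => /big vx.
    by rewrite -(real_normK (num_real (v x))) lerXn2r// nnegrE// divr_ge0// ltW.
  lra.
move=> x; have T0 : 0 < 2 * pi / k0 by rewrite divr_gt0// mulr_gt0// pi_gt0.
have [z zT <-] := periodic_reduce T0 vT x.
have TL : 2 * pi / k0 / 2 = L by rewrite /L; field; rewrite gt_eqF.
rewrite TL in zT; case/andP: zT => z1 z2.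
have tri : `|v z| <= `|v y| + `|v z - v y|.
  by rewrite -[X in `|X| <= _](subrKC (v y)) ler_normD.
have [yz|/ltW zy] := leP y z; first by have := osc _ _ y1 yz z2; lra.
by have := osc _ _ z1 zy y2; rewrite distrC; lra.
Qed.

End periodic.

(** * Instability near the bifurcation point *)

Section instability.
Context {R : realType}.

(** Periodicity supplies the uniform bounds on [h^3], its inverse, [V] and [V']; stability would put
    every [mu > 0] in the resolvent set. *)
Lemma periodic_unstable (T g M kappa : R) (h h1 h2 h3 h4 : R -> R) :
  profile g M h h1 h2 h3 h4 -> 0 < T -> (forall x, h (x + T) = h x) ->
  0 < kappa -> (forall x, kappa <= pot_fun g M h x) ->
  spectrally_unstable g M h.
Proof.
move=> pr T0 hT k0 kV stable.
have hC1 := profile01 pr; have ch := C1_cont hC1.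
have h1T := periodic_derive hC1 hT.
have h0 := profile_gt0 pr.
have h3C1 := C1M hC1 (C1M hC1 hC1).
have hE x : h x * (h x * h x) = h x ^+ 3 by rewrite !exprS expr0 mulr1.
have ch3 : continuous (fun x => h x ^+ 3).
  rewrite (_ : (fun x => h x ^+ 3) = (fun x => h x * (h x * h x))).
    exact: C1_cont h3C1.
  by apply/funext => x; rewrite hE.
have VC1 := pot_fun_C1 pr; have cV := C1_cont VC1.
have [K1 hK] : exists K, forall x, `|h x ^+ 3| <= K.
  by apply: (periodic_bounded T0) => // x; rewrite hT.
have [K2 VK] : exists K, forall x, `|pot_fun g M h x| <= K.
  by apply: (periodic_bounded T0) => // x; rewrite /pot_fun hT.
have [K3 VK'] : exists K, forall x, `|pot_fun' M h h1 x| <= K.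
  by apply: (periodic_bounded T0); [move=> x; rewrite /pot_fun' hT h1T|exact: VC1.2].
have h30 x : 0 < h x ^+ 3 by rewrite exprn_gt0.
have wC1 : continuous (weight h).
  move=> x; have c : {for x, continuous (fun x => (h x ^+ 3)^-1)}.
    by apply: continuousV; [rewrite gt_eqF|exact: ch3].
  exact: c.
have [K4 wK] : exists K, forall x, `|weight h x| <= K.
  by apply: (periodic_bounded T0) => // x; rewrite /weight hT.
have K10 : 0 < K1 := lt_le_trans (h30 0) (le_trans (ler_norm _) (hK 0)).
apply: (@no_resolvent R (weight h) (pot_fun g M h) K1^-1 K4 K2) => //.
- by rewrite invr_gt0.
- move=> x; rewrite /weight lef_pV2 ?posrE//.
  exact: le_trans (ler_norm _) (hK x).
- by move=> x; exact: le_trans (ler_norm _) (wK x).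
- apply: (exists_positive_energy VC1 k0) => x; rewrite kV/=.
  exact: le_trans (ler_norm _) (VK x).
- move=> mu mu0; apply: (resolvent_inverts pr hK VK VK' mu0).
  apply: contrapT => nres; have := stable _ nres.
  by rewrite /= leNgt mu0.
Qed.

(** For [h <= 1 + e] the Gibbs factor is at least [(1 - 3 e) / 4], so [V + g >= (g + k0^2) (1 - e)
    (1 - 3 e) >= (g + k0^2) (1 - 4 e)]. The value of [e] is the one for which
    [4 e (g + k0^2) = k0^2 / 2]; it is at most 1/8, which keeps [1 - 3 e] positive. *)
Lemma pot_fun_lower (k0 g M e : R) (h : R -> R) (x : R) : 0 < k0 -> 0 < g ->
  e = k0 ^+ 2 / (8 * (g + k0 ^+ 2)) -> `|h x - 1| <= e ->
  (4 * g + 4 * k0 ^+ 2) * (1 - e) <= M -> k0 ^+ 2 / 2 <= pot_fun g M h x.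
Proof.
move=> k00 g0 eE; rewrite ler_norml => /andP[he1 he2] Me.
have k2 : 0 < k0 ^+ 2 by rewrite exprn_gt0.
have s0 : 0 < g + k0 ^+ 2 by rewrite addr_gt0.
have es : e * (8 * (g + k0 ^+ 2)) = k0 ^+ 2 by rewrite eE divfK// gt_eqF// mulr_gt0.
have e0 : 0 < e by rewrite eE divr_gt0// mulr_gt0.
have e8 : e <= 1 / 8.
  by rewrite eE ler_pdivrMr ?mulr_gt0//; lra.
have h1 : h x <= 1 + e by lra.
have h0 : 0 < h x by lra.
rewrite /pot_fun /gibbs.
have den0 : 0 < h x * (1 + h x) ^+ 2 by rewrite mulr_gt0// exprn_gt0// addr_gt0.
have le1 : h x * (1 + h x) ^+ 2 <= (1 + e) * (2 + e) ^+ 2.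
  apply: ler_pM; [exact: ltW|exact: sqr_ge0|exact: h1|].
  by apply: lerXn2r; rewrite ?nnegrE; lra.
have le2 : (1 - 3 * e) * ((1 + e) * (2 + e) ^+ 2) <= 4.
  have e2 : 0 <= e ^+ 2 := sqr_ge0 e.
  have e3 : 0 <= e ^+ 3 by rewrite exprn_ge0// ltW.
  have e4 : 0 <= e ^+ 4 by rewrite exprn_ge0// ltW.
  have -> : (1 - 3 * e) * ((1 + e) * (2 + e) ^+ 2)
    = 4 - 4 * e - 19 * e ^+ 2 - 14 * e ^+ 3 - 3 * e ^+ 4 by ring.
  lra.
have le3 : (1 - 3 * e) / 4 <= (h x * (1 + h x) ^+ 2)^-1.
  rewrite -[X in _ <= X]mul1r ler_pdivlMr// mulrAC ler_pdivrMr// mul1r.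
  by apply: le_trans le2; apply: ler_wpM2l le1; lra.
have M0 : 0 < M by apply: lt_le_trans Me; apply: mulr_gt0; lra.
have le4 : (4 * g + 4 * k0 ^+ 2) * (1 - e) * ((1 - 3 * e) / 4) <= M / (h x * (1 + h x) ^+ 2).
  by apply: ler_pM => //; [apply: mulr_ge0|]; lra.
have : (4 * g + 4 * k0 ^+ 2) * (1 - e) * ((1 - 3 * e) / 4) =
   (g + k0 ^+ 2) - e * (8 * (g + k0 ^+ 2)) / 2 + 3 * (e ^+ 2 * (g + k0 ^+ 2)) by field.
have : 0 <= e ^+ 2 * (g + k0 ^+ 2) by rewrite mulr_ge0 ?sqr_ge0// ltW.
rewrite es; lra.
Qed.

End instability.

Theorem theorem1p6 (R : realType) (g k0 : R) (g_gt0 : 0 < g) (k0_gt0 : 0 < k0)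
    (eps : R) (eps_gt0 : 0 < eps) (v : R -> R -> R) (M : R -> R)
    (branch : local_bifurcation_branch k0 g eps v M) :
  exists s0 : R, 0 < s0 <= eps /\
    forall s : R, `|s| < s0 ->
      stationary_solution g (M s) (fun x => 1 + v s x) /\
      spectrally_unstable g (M s) (fun x => 1 + v s x).
Proof.
have [inU sol contv contM [Cv expv] [CM expM]] := branch.
have n0 : `|0 : R| < eps by rewrite normr0.
have H2 s : `|s| < eps -> H2per k0 (v s) by move=> /inU[[]].
(* A property that holds near 0 holds at 0, where the expansion bound reads [H2per_norm (v 0) <= 0].
   This anchors the continuity of the branch at the trivial solution. *)
have v0 : v 0 = (fun=> 0).
  have := nbhs_singleton expv.
  rewrite (_ : (fun x => v 0 x - 0 * cos (k0 * x)) = v 0); last first.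
    by apply/funext => x; rewrite mul0r subr0.
  rewrite expr0n mulr0 => nv0; apply/funext => x.
  apply/eqP; rewrite -normr_le0; apply/ler_addgt0Pl => e e0; rewrite addr0.
  have [d d0 vd] := H2per_sup k0_gt0 e0.
  by apply: vd; [exact: H2|exact: le_trans nv0 (ltW d0)].
have M0 : M 0 = Mstar k0 g.
  by apply/eqP; rewrite -subr_eq0 -normr_le0 (le_trans (nbhs_singleton expM))// expr0n mulr0.
have k2 : 0 < k0 ^+ 2 by rewrite exprn_gt0.
pose e := k0 ^+ 2 / (8 * (g + k0 ^+ 2)).
have e0 : 0 < e by rewrite divr_gt0// mulr_gt0// addr_gt0.
have [d d0 vd] := H2per_sup k0_gt0 e0.
have Ms0 : 0 < Mstar k0 g by rewrite /Mstar addr_gt0 ?mulr_gt0.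
have nearv : \forall t \near (0 : R), H2per_norm k0 (v t) <= d.
  have /cvgrPdist_le/(_ _ d0) := contv _ n0.
  apply: filterS => t; rewrite sub0r normrN v0.
  rewrite (_ : v t \- _ = v t); last by apply/funext => x; rewrite /= subr0.
  exact/le_trans/ler_norm.
have nearM : \forall t \near (0 : R), `|Mstar k0 g - M t| <= Mstar k0 g * e.
  have /cvgrPdist_le := contM _ n0; rewrite M0; apply.
  by rewrite mulr_gt0.
have near0 : nbhs (0 : R) [set t | H2per_norm k0 (v t) <= d /\
    `|Mstar k0 g - M t| <= Mstar k0 g * e] by exact: filterI nearv nearM.
move/nbhs_ballP : near0 => [r /= r0 rball].
exists (Num.min r eps); split.
  by rewrite lt_min r0 eps_gt0/= ge_min lexx orbT.
move=> s; rewrite lt_min => /andP[sr seps].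
have [] : H2per_norm k0 (v s) <= d /\ `|Mstar k0 g - M s| <= Mstar k0 g * e.
  by apply: rball; rewrite /ball/= sub0r normrN.
move=> vs Ms; have [vT _ _] := H2 _ seps.
have [h1 [h2 [h3 [h4 pr]]]] := profile_of_solution (inU _ seps) (sol _ seps).
split; first exact: profile_stationary pr.
have T0 : 0 < 2 * pi / k0 by rewrite divr_gt0// mulr_gt0// pi_gt0.
apply: (periodic_unstable pr T0 _ (_ : 0 < k0 ^+ 2 / 2)).
- by move=> x; rewrite vT.
- by rewrite divr_gt0.
- move=> x; apply: (@pot_fun_lower R k0 g (M s) e) => //.
    by rewrite addrC addKr; apply: vd vs _; exact: H2.
  by move: Ms; rewrite ler_norml /Mstar; lra.
Qed.
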